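(* Let $u_0,u_1\in\mathrm{PSH}^-(D)$ be such that, for $j=0,1$, the set $A_j=\{z:u_j(z)=-\infty\}$ is closed in $D$ and $u_j$ is locally bounded on $D\setminus A_j$. Let $P=P(g_{u_0},g_{u_1})$. If $\Phi\in\mathrm{PSH}^-(D\times S)$ satisfies $$\limsup_{(x,\zeta)\to(z,\zeta_0)}\Phi(x,\zeta)\le u_j(z)\quad\text{for all }z\in D,\ \zeta_0\in S_j,\ j=0,1,$$ then $\Phi(z,\zeta)\le P(z)$ for all $z\in D$, $\zeta\in S$. In particular, if $u_j=g_{u_j}$ for $j=0,1$, then the largest $\Phi\in\mathrm{PSH}^-(D\times S)$ satisfying this condition is $\Phi(z,\zeta)=P(z)$ (independent of $\zeta$).
   Context: $D\subset\mathbb C^n$ is a bounded hyperconvex domain; $\mathrm{PSH}^-(\Omega)$ denotes the nonpositive plurisubharmonic functions on $\Omega$. $S=\{\zeta\in\mathbb C:1<|\zeta|<e\}$, $S_0=\{|\zeta|=1\}$, $S_1=\{|\zeta|=e\}$. For $u\in\mathrm{PSH}^-(D)$, $g_u(z)=\limsup_{x\to z}\sup\{v(x):v\in\mathrm{PSH}^-(D),\ v\le u+O(1)\}$ (i.e. $v\le u+c_v$ on $D$ for some constant $c_v$). For plurisubharmonic $u,v$ on $D$, $P(u,v)$ denotes the largest plurisubharmonic function on $D$ that is $\le\min\{u,v\}$. *)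

(* Defs.v *)
From Stdlib Require Import Reals Lra Classical ClassicalEpsilon.
From Stdlib Require Fin.
Open Scope R_scope.

Definition C : Type := (R * R)%type.
Definition Cadd (a b : C) : C := (fst a + fst b, snd a + snd b).
Definition Cmul (a b : C) : C :=
  (fst a * fst b - snd a * snd b, fst a * snd b + snd a * fst b).
Definition Cmod (a : C) : R := sqrt (fst a ^ 2 + snd a ^ 2).
Definition Cdist (a b : C) : R := Cmod (fst a - fst b, snd a - snd b).

Definition Cn (m : nat) : Type := Fin.t m -> C.
Definition Cn_add {m} (a b : Cn m) : Cn m := fun i => Cadd (a i) (b i).
Definition Cn_scal {m} (l : C) (b : Cn m) : Cn m := fun i => Cmul l (b i).
(* polydisc (max-norm ball) of radius r centred at z; it induces the usual topology *)
Definition ballN {m} (z : Cn m) (r : R) (x : Cn m) : Prop :=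
  forall i : Fin.t m, Cdist (x i) (z i) < r.

(* point (z, zeta) of C^n x C, encoded in C^(n+1) with zeta as coordinate F1 *)
Definition pt {n} (zeta : C) (z : Cn n) : Cn (S n) :=
  fun i => Fin.caseS' i (fun _ => C) zeta z.
Definition tl {n} (p : Cn (S n)) : Cn n := fun j => p (Fin.FS j).
Definition hd {n} (p : Cn (S n)) : C := p Fin.F1.

Inductive ER : Type := MInf | EFin (r : R) | PInf.
Definition ER_le (a b : ER) : Prop :=
  match a, b with
  | MInf, _ => True
  | _, PInf => True
  | EFin x, EFin y => x <= y
  | _, _ => False
  end.
Definition ER_addR (a : ER) (c : R) : ER :=
  match a with EFin x => EFin (x + c) | _ => a end.
Definition is_ER_sup (A : ER -> Prop) (s : ER) : Prop :=
  (forall a, A a -> ER_le a s) /\ (forall t, (forall a, A a -> ER_le a t) -> ER_le s t).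
Definition is_ER_inf (A : ER -> Prop) (s : ER) : Prop :=
  (forall a, A a -> ER_le s a) /\ (forall t, (forall a, A a -> ER_le t a) -> ER_le t s).
Definition ER_sup (A : ER -> Prop) : ER := epsilon (inhabits MInf) (is_ER_sup A).
Definition ER_inf (A : ER -> Prop) : ER := epsilon (inhabits MInf) (is_ER_inf A).

(* limsup_{x -> p, x in E} f x, where (near r) is the r-neighbourhood of p *)
Definition limsup_near {X : Type} (near : R -> X -> Prop) (E : X -> Prop) (f : X -> ER) : ER :=
  ER_inf (fun a => exists r, 0 < r /\
            a = ER_sup (fun b => exists x, E x /\ near r x /\ b = f x)).

Definition Cdisk (c : C) (r : R) (l : C) : Prop := Cdist l c < r.
Definition cont_on_C (U : C -> Prop) (h : C -> R) : Prop :=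
  forall p, U p -> forall eps, 0 < eps -> exists del, 0 < del /\
    forall q, U q -> Cdist q p < del -> Rabs (h q - h p) < eps.
Definition harmonic_on (U : C -> Prop) (h : C -> R) : Prop :=
  exists hx hy hxx hxy hyx hyy : C -> R,
    (forall p, U p ->
       derivable_pt_lim (fun t => h (t, snd p)) (fst p) (hx p) /\
       derivable_pt_lim (fun t => h (fst p, t)) (snd p) (hy p) /\
       derivable_pt_lim (fun t => hx (t, snd p)) (fst p) (hxx p) /\
       derivable_pt_lim (fun t => hx (fst p, t)) (snd p) (hxy p) /\
       derivable_pt_lim (fun t => hy (t, snd p)) (fst p) (hyx p) /\
       derivable_pt_lim (fun t => hy (fst p, t)) (snd p) (hyy p) /\
       hxx p + hyy p = 0) /\
    cont_on_C U hxx /\ cont_on_C U hxy /\ cont_on_C U hyx /\ cont_on_C U hyy.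
Definition usc_on_C (U : C -> Prop) (f : C -> ER) : Prop :=
  forall l, U l -> ER_le (limsup_near (fun r x => Cdist x l < r) U f) (f l).
(* subharmonic on the open set U (Rudin's definition via harmonic majorants on discs) *)
Definition subharmonic_on (U : C -> Prop) (f : C -> ER) : Prop :=
  (forall l, U l -> f l <> PInf) /\ usc_on_C U f /\
  forall (c : C) (r : R) (h : C -> R), 0 < r ->
    (forall l, Cdist l c <= r -> U l) ->
    cont_on_C (fun l => Cdist l c <= r) h ->
    harmonic_on (Cdisk c r) h ->
    (forall l, Cdist l c = r -> ER_le (f l) (EFin (h l))) ->
    forall l, Cdist l c < r -> ER_le (f l) (EFin (h l)).

Definition usc_on {m} (Om : Cn m -> Prop) (u : Cn m -> ER) : Prop :=
  forall z, Om z -> ER_le (limsup_near (fun r x => ballN z r x) Om u) (u z).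
(* plurisubharmonic on Om: values in [-oo,+oo), usc, subharmonic on complex lines
   (the constant -oo is allowed) *)
Definition psh_on {m} (Om : Cn m -> Prop) (u : Cn m -> ER) : Prop :=
  (forall z, Om z -> u z <> PInf) /\ usc_on Om u /\
  forall a b : Cn m,
    subharmonic_on (fun l => Om (Cn_add a (Cn_scal l b))) (fun l => u (Cn_add a (Cn_scal l b))).
Definition PSHneg {m} (Om : Cn m -> Prop) (u : Cn m -> ER) : Prop :=
  psh_on Om u /\ forall z, Om z -> ER_le (u z) (EFin 0).

Definition open_set {m} (U : Cn m -> Prop) : Prop :=
  forall z, U z -> exists r, 0 < r /\ forall x, ballN z r x -> U x.
Definition connected_set {m} (D : Cn m -> Prop) : Prop :=
  forall U V : Cn m -> Prop, open_set U -> open_set V ->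
    (forall z, D z -> U z \/ V z) -> (exists z, D z /\ U z) -> (exists z, D z /\ V z) ->
    exists z, D z /\ U z /\ V z.
Definition bounded_set {m} (E : Cn m -> Prop) : Prop :=
  exists M, forall z, E z -> forall i, Cmod (z i) <= M.
Definition rel_compact {m} (D E : Cn m -> Prop) : Prop :=
  bounded_set E /\ forall w, (forall r, 0 < r -> exists z, E z /\ ballN w r z) -> D w.
Definition bounded_hyperconvex {m} (D : Cn m -> Prop) : Prop :=
  open_set D /\ connected_set D /\ (exists z, D z) /\ bounded_set D /\
  exists rho : Cn m -> R,
    psh_on D (fun z => EFin (rho z)) /\
    (forall z, D z -> rho z < 0) /\
    (forall z, D z -> forall eps, 0 < eps -> exists del, 0 < del /\
        forall x, D x -> ballN z del x -> Rabs (rho x - rho z) < eps) /\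
    (forall c, c < 0 -> rel_compact D (fun z => D z /\ rho z < c)).

Definition g_env {n} (D : Cn n -> Prop) (u : Cn n -> ER) (x : Cn n) : ER :=
  ER_sup (fun a => exists v, PSHneg D v /\
            (exists c : R, forall y, D y -> ER_le (v y) (ER_addR (u y) c)) /\ a = v x).
Definition g_of {n} (D : Cn n -> Prop) (u : Cn n -> ER) (z : Cn n) : ER :=
  limsup_near (fun r x => ballN z r x) D (g_env D u).
(* P(f1,f2): the largest psh function on D that is <= min(f1,f2), i.e. the
   pointwise supremum of all such functions *)
Definition Penv {n} (D : Cn n -> Prop) (f1 f2 : Cn n -> ER) (z : Cn n) : ER :=
  ER_sup (fun a => exists w, psh_on D w /\
            (forall y, D y -> ER_le (w y) (f1 y) /\ ER_le (w y) (f2 y)) /\ a = w z).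

Definition annS (l : C) : Prop := 1 < Cmod l < exp 1.
Definition S0 (l : C) : Prop := Cmod l = 1.
Definition S1 (l : C) : Prop := Cmod l = exp 1.
Definition DxS {n} (D : Cn n -> Prop) (p : Cn (S n)) : Prop := D (tl p) /\ annS (hd p).

Definition boundary_cond {n} (D : Cn n -> Prop) (u0 u1 : Cn n -> ER) (Phi : Cn (S n) -> ER) : Prop :=
  (forall z zeta0, D z -> S0 zeta0 ->
     ER_le (limsup_near (fun r p => ballN (pt zeta0 z) r p) (DxS D) Phi) (u0 z)) /\
  (forall z zeta0, D z -> S1 zeta0 ->
     ER_le (limsup_near (fun r p => ballN (pt zeta0 z) r p) (DxS D) Phi) (u1 z)).

Definition minf_closed_in {n} (D : Cn n -> Prop) (u : Cn n -> ER) : Prop :=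
  forall z, D z -> (forall r, 0 < r -> exists x, D x /\ ballN z r x /\ u x = MInf) -> u z = MInf.
Definition loc_bdd_off_poles {n} (D : Cn n -> Prop) (u : Cn n -> ER) : Prop :=
  forall z, D z -> u z <> MInf -> exists r M, 0 < r /\
    forall x, D x -> ballN z r x -> ER_le (EFin (- M)) (u x) /\ ER_le (u x) (EFin M).

(* Main.v *)
(* Let [Phi] be a competitor. By the three circles theorem [t |-> max_{|zeta| = e^t} Phi(z, zeta)]
   is convex, so at each point it has a supporting line, of slope [s] say. The partial
   Legendre transform [w_s(z) = inf_t (max_{|zeta| = e^t} Phi(z, zeta) - s t) + max(s, 0)] is
   plurisubharmonic by Kiselev's minimum principle. It is nonpositive, and the boundary condition
   gives [w_s <= u_j + O(1)] for [j = 0, 1]; hence [w_s <= g_{u_j}] and [w_s <= P]. Since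
   [Phi(z, zeta) <= w_s(z)] for the slope [s] of the supporting line at [log |zeta|], [Phi <= P].
   If [u_j = g_{u_j}], then the usc regularisation of [P] is plurisubharmonic and [<= u_j], so it
   equals [P], and [P] has the required boundary values.

   The minimum principle is proved by maximum principle arguments only: a usc function is
   subharmonic as soon as no strictly superharmonic quadratic polynomial touches it from above.
   If [w_s] is [< h] on a circle with [h] harmonic, convexity in [t] and a Bernstein-type
   approximation give a harmonic [H] on the disc such that [Phi - s log |zeta| < h] over the circle
   when [log |zeta| = H]; a penalty method carries this bound to the centre. *)

From Stdlib Require Import Reals Lra Psatz Classical ClassicalEpsilon FunctionalExtensionality.
From Stdlib Require Fin.
From Coquelicot Require Import Coquelicot.
Require Import Defs.
Open Scope R_scope.

(** [Phi] may take the value [-oo] and is only upper semicontinuous, so no minimising radius can be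
    differentiated, and plurisubharmonicity is tested on complex lines alone. Hence everything runs
    through upper bounds on circles and through touching polynomials, whose harmonic part is free
    and whose negative trace gives the contradiction.

    Harmonicity of [H] serves the penalty: in the Laplacian of the square of [log |zeta| - H], a
    direction of equal gradients kills the gradient term, and harmonicity of both functions the
    other one. Admissible radii over the circle are found only locally, with jumps. Convexity in [t]
    allows such choices to be averaged; random-walk averages are used because they are polynomials
    on the circle, hence boundary values of harmonic ones.

    The slope [s] depends on [(z, zeta)], but for fixed [s] the function [w_s] lives on all of [D],
    one competitor per point is enough for a supremum, and the constants growing with [|s|] vanish
    in the [O(1)] of [g_u]. The term [max(s, 0)] is the supremum of [s t] over [0 < t < 1]: small
    enough for [w_s <= 0], large enough for [Phi <= w_s] at the chosen point. *)

(** * Extended reals and upper limits *)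

Lemma ER_le_refl a : ER_le a a.
Proof. destruct a; simpl; auto; lra. Qed.

Lemma ER_le_trans a b c : ER_le a b -> ER_le b c -> ER_le a c.
Proof. destruct a, b, c; simpl; intros; auto; try contradiction; lra. Qed.

Lemma ER_le_antisym a b : ER_le a b -> ER_le b a -> a = b.
Proof.
  destruct a, b; simpl; intros; auto; try contradiction; f_equal; lra.
Qed.

Lemma ER_nle_le a b : ~ ER_le a b -> ER_le b a.
Proof.
  destruct a, b; simpl; intros; auto; try (exfalso; apply H; exact I); lra.
Qed.

Lemma ER_between a b : ~ ER_le b a -> exists k, ~ ER_le (EFin k) a /\ ~ ER_le b (EFin k).
Proof.
  destruct a as [|x|], b as [|y|]; simpl; intros; try tauto.
  - exists (y - 1); split; [tauto | lra].
  - exists 0; tauto.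
  - exists ((x + y) / 2); lra.
  - exists (x + 1); split; [lra | tauto].
Qed.

Lemma ER_sup_exists (A : ER -> Prop) : exists s, is_ER_sup A s.
Proof.
  destruct (classic (A PInf)) as [HP|HP].
  { exists PInf; split.
    - intros [| |] _; simpl; auto.
    - intros t Ht; exact (Ht _ HP). }
  destruct (classic (exists x, A (EFin x))) as [[x0 Hx0]|Hn].
  2:{ exists MInf; split.
      - intros [| |] Ha; simpl; auto. apply Hn; eauto.
      - simpl; auto. }
  destruct (classic (exists M, forall x, A (EFin x) -> x <= M)) as [[M HM]|Hub].
  - destruct (completeness (fun x => A (EFin x))) as [l [Hl1 Hl2]].
    + exists M; intros x Hx; auto.
    + eauto.
    + exists (EFin l); split.
      * intros [| |] Ha; simpl; auto; apply Hl1; auto.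
      * intros [| |] Ht; simpl; auto.
        -- apply (Ht _ Hx0).
        -- apply Hl2; intros y Hy; apply (Ht _ Hy).
  - exists PInf; split.
    + intros [| |] _; simpl; auto.
    + intros [|m|] Ht; simpl; auto.
      * apply (Ht _ Hx0).
      * apply Hub; exists m; intros x Hx; apply (Ht _ Hx).
Qed.

Definition ER_opp (a : ER) : ER :=
  match a with MInf => PInf | EFin x => EFin (- x) | PInf => MInf end.

Lemma ER_opp_opp a : ER_opp (ER_opp a) = a.
Proof. destruct a; simpl; auto; f_equal; lra. Qed.

Lemma ER_opp_le a b : ER_le a b -> ER_le (ER_opp b) (ER_opp a).
Proof. destruct a, b; simpl; auto; lra. Qed.

Lemma ER_sup_spec (A : ER -> Prop) : is_ER_sup A (ER_sup A).
Proof. unfold ER_sup; apply epsilon_spec, ER_sup_exists. Qed.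

Lemma ER_inf_spec (A : ER -> Prop) : is_ER_inf A (ER_inf A).
Proof.
  unfold ER_inf; apply epsilon_spec.
  destruct (ER_sup_exists (fun a => A (ER_opp a))) as [s [H1 H2]].
  exists (ER_opp s); split.
  - intros a Ha; rewrite <- (ER_opp_opp a); apply ER_opp_le, H1.
    now rewrite ER_opp_opp.
  - intros t Ht; rewrite <- (ER_opp_opp t); apply ER_opp_le, H2.
    intros a Ha; rewrite <- (ER_opp_opp a); apply ER_opp_le, Ht, Ha.
Qed.

(** The hypothesis [~ ER_le (EFin k) a] says [a < k]. Testing against real thresholds treats
    [a = MInf] and finite [a] alike, and for [a = PInf] there is nothing to test; upper
    semicontinuity is used below in this form. *)
Lemma limsup_le_iff {X : Type} (near : R -> X -> Prop) (E : X -> Prop) (f : X -> ER) (a : ER) :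
  ER_le (limsup_near near E f) a <->
  (forall k, ~ ER_le (EFin k) a ->
     exists r, 0 < r /\ forall x, E x -> near r x -> ER_le (f x) (EFin k)).
Proof.
  unfold limsup_near; set (A := fun a0 => _).
  destruct (ER_inf_spec A) as [H1 H2]; split.
  - intros Ha k Hk. apply NNPP; intro Hn.
    apply Hk; apply ER_le_trans with (2 := Ha), H2.
    intros b [r [Hr Hb]]. apply NNPP; intro Hkb; apply Hn.
    exists r; split; auto; intros x Ex Nx.
    apply ER_le_trans with b; [|now apply ER_nle_le].
    rewrite Hb; apply ER_sup_spec; eauto.
  - intros Hk; apply NNPP; intro Hn.
    destruct (ER_between _ _ Hn) as [k [Hk1 Hk2]].
    destruct (Hk k Hk1) as [r [Hr Hx]].
    apply Hk2. eapply ER_le_trans; [apply H1; exists r; split; [exact Hr|reflexivity]|].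
    apply ER_sup_spec; intros b [x [Ex [Nx ->]]]; auto.
Qed.

Lemma ER_le_limsup {X : Type} (near : R -> X -> Prop) (E : X -> Prop) (f : X -> ER) (x : X) :
  E x -> (forall r, 0 < r -> near r x) -> ER_le (f x) (limsup_near near E f).
Proof.
  intros Ex Nx. apply ER_inf_spec. intros b [r [Hr ->]]. apply ER_sup_spec; eauto.
Qed.

(** * Compactness *)

(* [near x r y] reads: y lies in the r-neighbourhood of x. *)
Definition compact_in {X : Type} (near : X -> R -> X -> Prop) (K : X -> Prop) : Prop :=
  forall Q : (X -> Prop) -> Prop,
    Q (fun _ => False) ->
    (forall A B : X -> Prop, (forall x, A x -> B x) -> Q B -> Q A) ->
    (forall A B, Q A -> Q B -> Q (fun x => A x \/ B x)) ->
    (forall x, K x -> exists r, 0 < r /\ Q (fun y => K y /\ near x r y)) ->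
    Q K.

Definition nearR (x r y : R) : Prop := Rabs (y - x) < r.

(** Compactness is phrased as an induction: a hereditary property of sets that is stable under
    unions and holds near every point of [K] holds for [K]. On an interval this is a supremum
    argument over the [c] for which the property holds on [[a, c]]. *)
Lemma compact_interval (a b : R) : compact_in nearR (fun x => a <= x <= b).
Proof.
  intros Q Q0 Qs Qu Ql.
  destruct (Rle_or_lt a b) as [Hab|Hab].
  2:{ apply Qs with (2 := Q0); intros; lra. }
  set (E := fun c => a <= c <= b /\ Q (fun x => a <= x <= c)).
  assert (Ea : E a).
  { split; [lra|]. destruct (Ql a) as [r [Hr Hq]]; [lra|].
    apply Qs with (2 := Hq); intros x Hx; split; [lra|].
    unfold nearR; replace (x - a) with 0 by lra; now rewrite Rabs_R0. }
  destruct (completeness E) as [c [Hc1 Hc2]].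
  - exists b; intros x [Hx _]; lra.
  - exists a; auto.
  - assert (Hac : a <= c) by (apply Hc1; auto).
    assert (Hcb : c <= b) by (apply Hc2; intros x [Hx _]; lra).
    destruct (Ql c) as [r [Hr Hq]]; [lra|].
    assert (Hx : exists x, E x /\ c - r < x).
    { apply NNPP; intro Hn. assert (c <= c - r); [|lra].
      apply Hc2; intros x Ex. apply Rnot_lt_le; intro; apply Hn; eauto. }
    destruct Hx as [x [[Hx1 Hx2] Hx3]].
    assert (Hxc : x <= c) by (apply Hc1; split; auto).
    assert (Hd : E (Rmin b (c + r / 2))).
    { split. { split; [apply Rmin_glb; lra | apply Rmin_l]. }
      apply Qs with (2 := Qu _ _ Hx2 Hq). intros y Hy.
      pose proof (Rmin_l b (c + r / 2)); pose proof (Rmin_r b (c + r / 2)).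
      destruct (Rle_or_lt y x); [left; lra|right; split; [lra|]].
      unfold nearR; apply Rabs_def1; lra. }
    apply Hc1 in Hd as Hd'.
    destruct (Rle_or_lt b (c + r / 2)) as [Hbc|Hbc].
    + destruct Hd as [_ Hd]. rewrite Rmin_left in Hd; auto.
    + rewrite Rmin_right in Hd'; lra.
Qed.

Definition near_prod {X Y : Type} (nX : X -> R -> X -> Prop) (nY : Y -> R -> Y -> Prop)
  (p : X * Y) (r : R) (q : X * Y) : Prop := nX (fst p) r (fst q) /\ nY (snd p) r (snd q).

(** The tube argument: the outer induction is on sets [A] with [A x L] good; for a fixed [x] the
    inner one builds a radius that serves for all of [L], which is why a radius occurs in the inner
    property. *)
Lemma compact_prod {X Y : Type} (nX : X -> R -> X -> Prop) (nY : Y -> R -> Y -> Prop)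
  (K : X -> Prop) (L : Y -> Prop) :
  (forall x r r' y, r <= r' -> nX x r y -> nX x r' y) ->
  (forall x r r' y, r <= r' -> nY x r y -> nY x r' y) ->
  compact_in nX K -> compact_in nY L ->
  compact_in (near_prod nX nY) (fun p => K (fst p) /\ L (snd p)).
Proof.
  intros mX mY cK cL Q Q0 Qs Qu Ql.
  assert (H : Q (fun p : X * Y => K (fst p) /\ L (snd p))).
  { apply (cK (fun A => Q (fun p : X * Y => A (fst p) /\ L (snd p)))).
    - apply Qs with (2 := Q0); tauto.
    - intros A B AB QB; apply Qs with (2 := QB); intros p [? ?]; auto.
    - intros A B QA QB; apply Qs with (2 := Qu _ _ QA QB); intros p; tauto.
    - intros x Kx.
      destruct (cL (fun A => exists r, 0 < r /\
                 Q (fun p : X * Y => (K (fst p) /\ nX x r (fst p)) /\ A (snd p))))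
        as [r [Hr Hq]].
      + exists 1; split; [lra|]; apply Qs with (2 := Q0); tauto.
      + intros A B AB [r [Hr QB]]; exists r; split; auto.
        apply Qs with (2 := QB); intros p [? ?]; auto.
      + intros A B [r [Hr QA]] [r' [Hr' QB]].
        exists (Rmin r r'); split; [now apply Rmin_glb_lt|].
        apply Qs with (2 := Qu _ _ QA QB). intros p [[k1 k2] [a|b]].
        * left; split; auto; split; auto; apply mX with (2 := k2), Rmin_l.
        * right; split; auto; split; auto; apply mX with (2 := k2), Rmin_r.
      + intros y Ly. destruct (Ql (x, y)) as [r [Hr Hq]]; [simpl; auto|].
        exists r; split; auto; exists r; split; auto.
        apply Qs with (2 := Hq); intros [x' y']; unfold near_prod; simpl; tauto.
      + exists r; split; auto. }
  exact H.
Qed.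

Lemma compact_closed {X : Type} (near : X -> R -> X -> Prop) (K F : X -> Prop) :
  compact_in near K ->
  (forall x, K x -> ~ F x -> exists r, 0 < r /\ forall y, near x r y -> ~ F y) ->
  compact_in near (fun x => K x /\ F x).
Proof.
  intros cK cF Q Q0 Qs Qu Ql.
  apply (cK (fun A => Q (fun x => A x /\ F x))).
  - apply Qs with (2 := Q0); tauto.
  - intros A B AB QB; apply Qs with (2 := QB); intros x [? ?]; auto.
  - intros A B QA QB; apply Qs with (2 := Qu _ _ QA QB); intros; tauto.
  - intros x Kx. destruct (classic (F x)) as [Fx|Fx].
    + destruct (Ql x) as [r [Hr Hq]]; auto.
      exists r; split; auto; apply Qs with (2 := Hq); tauto.
    + destruct (cF x Kx Fx) as [r [Hr Hn]].
      exists r; split; auto; apply Qs with (2 := Q0).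
      intros y [[_ Ny] Fy]; exact (Hn y Ny Fy).
Qed.

Lemma compact_near {X : Type} (near near' : X -> R -> X -> Prop) (K : X -> Prop) :
  (forall r, 0 < r -> exists r', 0 < r' /\ forall x y, near' x r' y -> near x r y) ->
  compact_in near' K -> compact_in near K.
Proof.
  intros Hn cK Q Q0 Qs Qu Ql. apply cK; auto.
  intros x Kx; destruct (Ql x Kx) as [r [Hr Hq]], (Hn r Hr) as [r' [Hr' Hn']].
  exists r'; split; auto; apply Qs with (2 := Hq); intros y [? ?]; auto.
Qed.

Lemma compact_ext {X : Type} (near : X -> R -> X -> Prop) (K K' : X -> Prop) :
  (forall x, K x <-> K' x) -> compact_in near K -> compact_in near K'.
Proof.
  intros HK cK Q Q0 Qs Qu Ql. apply Qs with K; [apply HK|]. apply cK; auto.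
  intros x Kx; destruct (Ql x) as [r [Hr Hq]]; [now apply HK|].
  exists r; split; auto; apply Qs with (2 := Hq); intros y [? ?]; split; auto; now apply HK.
Qed.

Definition usc_in {X : Type} (near : X -> R -> X -> Prop) (K : X -> Prop) (f : X -> ER) : Prop :=
  forall x k, K x -> ~ ER_le (EFin k) (f x) ->
    exists r, 0 < r /\ forall y, K y -> near x r y -> ER_le (f y) (EFin k).

(** The induction runs on the property of having a real bound strictly below the supremum [s]. If no
    point attained [s], upper semicontinuity would give this locally, and [K] itself would have such
    a bound. *)
Lemma usc_attains_max {X : Type} (near : X -> R -> X -> Prop) (K : X -> Prop) (f : X -> ER) :
  compact_in near K -> usc_in near K f -> (forall x, K x -> f x <> PInf) ->
  (exists x, K x) -> exists x, K x /\ forall y, K y -> ER_le (f y) (f x).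
Proof.
  intros cK uf fin [x0 Kx0].
  destruct (ER_sup_spec (fun a => exists x, K x /\ a = f x)) as [S1 S2].
  set (s := ER_sup _) in *.
  apply NNPP; intro Hn.
  assert (Hlt : forall x, K x -> ~ ER_le s (f x)).
  { intros x Kx Hs; apply Hn; exists x; split; auto; intros y Ky.
    apply ER_le_trans with (2 := Hs), S1; eauto. }
  destruct (cK (fun A => exists k, ~ ER_le s (EFin k) /\ forall y, A y -> ER_le (f y) (EFin k)))
    as [k [Hk Hle]].
  - destruct (ER_between _ _ (Hlt x0 Kx0)) as [k [_ Hk]]; exists k; split; auto; tauto.
  - intros A B AB [k [Hk Hb]]; exists k; split; auto.
  - intros A B [k [Hk Ha]] [k' [Hk' Hb]].
    exists (Rmax k k'); split.
    + destruct (Rle_or_lt k k'); [rewrite Rmax_right|rewrite Rmax_left]; auto; lra.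
    + intros y [Ay|By].
      * apply ER_le_trans with (1 := Ha y Ay); simpl; apply Rmax_l.
      * apply ER_le_trans with (1 := Hb y By); simpl; apply Rmax_r.
  - intros x Kx. destruct (ER_between _ _ (Hlt x Kx)) as [k [Hk1 Hk2]].
    destruct (uf x k Kx Hk1) as [r [Hr Hu]].
    exists r; split; auto; exists k; split; auto; intros y [? ?]; auto.
  - apply Hk, S2; intros a [x [Kx ->]]; auto.
Qed.

Definition cont_in {X : Type} (near : X -> R -> X -> Prop) (K : X -> Prop) (g : X -> R) : Prop :=
  forall x eps, K x -> 0 < eps ->
    exists r, 0 < r /\ forall y, K y -> near x r y -> Rabs (g y - g x) < eps.

Lemma usc_in_addR {X : Type} (near : X -> R -> X -> Prop) (K : X -> Prop) (f : X -> ER) (g : X -> R) :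
  (forall x r r' y, r <= r' -> near x r y -> near x r' y) ->
  usc_in near K f -> cont_in near K g -> usc_in near K (fun x => ER_addR (f x) (g x)).
Proof.
  intros mn uf cg x k Kx Hk.
  (* The slack between [f x + g x] and [k] is split: [k1] bounds [f] nearby, [eps] the variation of
     [g]. When [f x] is [MInf], any [k1] low enough serves. *)
  assert (H : exists k1 eps, 0 < eps /\ ~ ER_le (EFin k1) (f x) /\ k1 + g x + eps <= k).
  { destruct (f x) as [|a|]; simpl in *.
    - exists (k - g x - 1), 1; split; [lra|split; [tauto|lra]].
    - exists (a + (k - a - g x) / 2), ((k - a - g x) / 2); lra.
    - tauto. }
  destruct H as [k1 [eps [He [H1 H2]]]].
  destruct (uf x k1 Kx H1) as [r [Hr Hu]], (cg x eps Kx He) as [r' [Hr' Hc]].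
  exists (Rmin r r'); split; [now apply Rmin_glb_lt|]; intros y Ky Ny.
  specialize (Hu y Ky (mn _ _ _ _ (Rmin_l _ _) Ny)).
  specialize (Hc y Ky (mn _ _ _ _ (Rmin_r _ _) Ny)); apply Rabs_def2 in Hc.
  destruct (f y); simpl in *; auto; lra.
Qed.

(** * Plane geometry *)

Lemma Cmod_ge0 (a : C) : 0 <= Cmod a.
Proof. apply sqrt_pos. Qed.

Lemma Cmod_sqr (a : C) : Cmod a ^ 2 = fst a ^ 2 + snd a ^ 2.
Proof. unfold Cmod; rewrite pow2_sqrt; auto; nra. Qed.

Lemma Cmod_lt (a : C) (r : R) : 0 <= r -> Cmod a < r <-> fst a ^ 2 + snd a ^ 2 < r ^ 2.
Proof. intros; rewrite <- Cmod_sqr; pose proof (Cmod_ge0 a); split; nra. Qed.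

Lemma Cmod_le (a : C) (r : R) : 0 <= r -> Cmod a <= r <-> fst a ^ 2 + snd a ^ 2 <= r ^ 2.
Proof. intros; rewrite <- Cmod_sqr; pose proof (Cmod_ge0 a); split; nra. Qed.

Lemma Cmod_eq (a : C) (r : R) : 0 <= r -> Cmod a = r <-> fst a ^ 2 + snd a ^ 2 = r ^ 2.
Proof. intros; rewrite <- Cmod_sqr; pose proof (Cmod_ge0 a); split; [intros ->; auto|nra]. Qed.

Lemma Cmod_triangle (a b : C) : Cmod (Cadd a b) <= Cmod a + Cmod b.
Proof. exact (Complex.Cmod_triangle a b). Qed.

Lemma Cmod_mul (a b : C) : Cmod (Cmul a b) = Cmod a * Cmod b.
Proof. exact (Complex.Cmod_mult a b). Qed.

Lemma Cdist_triangle (a b c : C) : Cdist a c <= Cdist a b + Cdist b c.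
Proof.
  unfold Cdist. eapply Rle_trans; [|apply Cmod_triangle].
  right; f_equal; unfold Cadd; simpl; f_equal; ring.
Qed.

Lemma Cdist_sym (a b : C) : Cdist a b = Cdist b a.
Proof. unfold Cdist, Cmod; f_equal; simpl; ring. Qed.

Lemma Cdist_refl (a : C) : Cdist a a = 0.
Proof. apply Cmod_eq; simpl; [lra|ring]. Qed.

Lemma Cdist_0 (a : C) : Cdist a (0, 0) = Cmod a.
Proof. unfold Cdist; f_equal; destruct a; simpl; f_equal; ring. Qed.

Lemma Cdist_fst_snd (a b : C) (r : R) :
  Rabs (fst a - fst b) < r / 2 -> Rabs (snd a - snd b) < r / 2 -> Cdist a b < r.
Proof.
  intros H1 H2. pose proof (Rabs_pos (fst a - fst b)).
  apply Cmod_lt; [lra|]; cbn [fst snd].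
  rewrite <- (pow2_abs (fst a - fst b)), <- (pow2_abs (snd a - snd b)).
  pose proof (Rabs_pos (snd a - snd b)); nra.
Qed.

Lemma Cdist_fst (a b : C) : Rabs (fst a - fst b) <= Cdist a b.
Proof.
  unfold Cdist, Cmod; cbn [fst snd].
  rewrite <- sqrt_Rsqr_abs; apply sqrt_le_1_alt; unfold Rsqr.
  pose proof (pow2_ge_0 (fst a - fst b)); pose proof (pow2_ge_0 (snd a - snd b)); lra.
Qed.

Lemma Cdist_snd (a b : C) : Rabs (snd a - snd b) <= Cdist a b.
Proof.
  unfold Cdist, Cmod; cbn [fst snd].
  rewrite <- sqrt_Rsqr_abs; apply sqrt_le_1_alt; unfold Rsqr.
  pose proof (pow2_ge_0 (fst a - fst b)); pose proof (pow2_ge_0 (snd a - snd b)); lra.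
Qed.

Definition nearC (x : C) (r : R) (y : C) : Prop := Cdist y x < r.

Lemma nearC_mono x r r' y : r <= r' -> nearC x r y -> nearC x r' y.
Proof. unfold nearC; lra. Qed.

Lemma compact_annulus (c : C) (a b : R) :
  compact_in nearC (fun l => a <= Cdist l c <= b).
Proof.
  assert (H : compact_in nearC (fun l => fst c - b <= fst l <= fst c + b /\
                                         snd c - b <= snd l <= snd c + b)).
  { apply compact_near with (near' := near_prod nearR nearR).
    - intros r Hr; exists (r / 2); split; [lra|]; intros x y [H1 H2].
      now apply Cdist_fst_snd.
    - apply (compact_prod nearR nearR (fun x => fst c - b <= x <= fst c + b)
               (fun x => snd c - b <= x <= snd c + b)); unfold nearR;
      try apply compact_interval; intros; lra. }
  apply (compact_closed _ _ (fun l => a <= Cdist l c <= b)) in H.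
  - eapply compact_ext with (2 := H); intros x; simpl; split; [tauto|].
    intros Hx; split; auto.
    pose proof (Cdist_fst x c); pose proof (Cdist_snd x c).
    split; split; unfold Rabs in *; repeat destruct Rcase_abs; lra.
  - intros x _ Hx.
    assert (Hx' : Cdist x c < a \/ b < Cdist x c) by lra.
    destruct Hx' as [Hx'|Hx'].
    + exists (a - Cdist x c); split; [lra|]; intros y Hy; unfold nearC in Hy.
      pose proof (Cdist_triangle y x c); lra.
    + exists (Cdist x c - b); split; [lra|]; intros y Hy; unfold nearC in Hy.
      pose proof (Cdist_triangle x y c); rewrite (Cdist_sym x y) in *; lra.
Qed.

Lemma compact_Cmod (a b : R) : compact_in nearC (fun l => a <= Cmod l <= b).
Proof.
  eapply compact_ext with (2 := compact_annulus (0, 0) a b).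
  intros x; simpl; now rewrite Cdist_0.
Qed.

(** * Continuity and harmonicity in the plane *)

Definition contC (g : C -> R) (p : C) : Prop :=
  forall eps, 0 < eps -> exists del, 0 < del /\
    forall q, Cdist q p < del -> Rabs (g q - g p) < eps.

Lemma contC_continuous (g : C -> R) (p : C) :
  continuous (T := prod_UniformSpace R_UniformSpace R_UniformSpace) (U := R_UniformSpace) g p ->
  contC g p.
Proof.
  intros Hg eps He.
  destruct (proj1 (filterlim_locally _ _) Hg (mkposreal eps He)) as [d Hd].
  exists d; split; [apply cond_pos|]; intros q Hq.
  apply (Hd q); split; simpl.
  - apply Rle_lt_trans with (2 := Hq), Cdist_fst.
  - apply Rle_lt_trans with (2 := Hq), Cdist_snd.
Qed.

Lemma continuous_contC (g : C -> R) (p : C) : contC g p ->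
  continuous (T := prod_UniformSpace R_UniformSpace R_UniformSpace) (U := R_UniformSpace) g p.
Proof.
  intros Hg; apply filterlim_locally; intros eps.
  destruct (Hg eps (cond_pos eps)) as [d [Hd H]].
  assert (Hd2 : 0 < d / 2) by lra.
  exists (mkposreal _ Hd2); intros q [H1 H2]; apply H, Cdist_fst_snd; [apply H1|apply H2].
Qed.

Lemma contC_const k p : contC (fun _ => k) p.
Proof. apply contC_continuous, continuous_const. Qed.
Lemma contC_fst p : contC (fun q => fst q) p.
Proof. apply contC_continuous, continuous_fst. Qed.
Lemma contC_snd p : contC (fun q => snd q) p.
Proof. apply contC_continuous, continuous_snd. Qed.
Lemma contC_plus f g p : contC f p -> contC g p -> contC (fun q => f q + g q) p.
Proof.
  intros; apply contC_continuous.
  apply (continuous_plus (V := R_NormedModule)); now apply continuous_contC.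
Qed.
Lemma contC_mult f g p : contC f p -> contC g p -> contC (fun q => f q * g q) p.
Proof.
  intros; apply contC_continuous.
  apply (continuous_mult (K := R_AbsRing)); now apply continuous_contC.
Qed.
Lemma contC_comp f (g : R -> R) p : contC f p -> continuity_pt g (f p) -> contC (fun q => g (f q)) p.
Proof.
  intros; apply contC_continuous.
  apply continuous_comp; [now apply continuous_contC|now apply continuity_pt_filterlim].
Qed.
Lemma contC_opp f p : contC f p -> contC (fun q => - f q) p.
Proof. intros; apply (contC_comp f Ropp); auto; apply continuity_pt_opp, continuity_pt_id. Qed.
Lemma contC_minus f g p : contC f p -> contC g p -> contC (fun q => f q - g q) p.
Proof. intros; apply (contC_plus f (fun q => - g q)); auto; now apply contC_opp. Qed.
Lemma contC_pow f k p : contC f p -> contC (fun q => f q ^ k) p.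
Proof. induction k; intros; simpl; [apply contC_const|apply contC_mult; auto]. Qed.
Lemma contC_Cdist c p : contC (fun q => Cdist q c) p.
Proof.
  intros eps He; exists eps; split; auto; intros q Hq.
  pose proof (Cdist_triangle q p c); pose proof (Cdist_triangle p q c).
  rewrite (Cdist_sym p q) in *. apply Rabs_def1; lra.
Qed.
Lemma contC_Cmod p : contC Cmod p.
Proof.
  replace Cmod with (fun q => Cdist q (0, 0)); [apply contC_Cdist|].
  extensionality q; apply Cdist_0.
Qed.
Lemma contC_Rinv f p : contC f p -> f p <> 0 -> contC (fun q => / f q) p.
Proof.
  intros; apply (contC_comp f Rinv); auto.
  apply (continuity_pt_inv id); [apply continuity_pt_id|auto].
Qed.
Lemma contC_ln f p : contC f p -> 0 < f p -> contC (fun q => ln (f q)) p.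
Proof.
  intros; apply (contC_comp f ln); auto.
  apply derivable_continuous_pt; exists (/ f p); now apply derivable_pt_lim_ln.
Qed.

Ltac contC_auto :=
  repeat first [ apply contC_const | apply contC_fst | apply contC_snd | apply contC_Cmod
               | apply contC_plus | apply contC_minus | apply contC_mult | apply contC_opp
               | apply contC_pow ].

Lemma contC_on U g : (forall p, U p -> contC g p) -> cont_on_C U g.
Proof.
  intros H p Up eps He; destruct (H p Up eps He) as [d [Hd Hd']]; exists d; auto.
Qed.

Lemma contC_in K g : (forall p, K p -> contC g p) -> cont_in nearC K g.
Proof.
  intros H p eps Up He; destruct (H p Up eps He) as [d [Hd Hd']]; exists d; auto.
Qed.

(* The trace-free quadratic polynomials are the harmonic ones. *)
Definition quad (al be ga de x y : R) : R :=
  al * x + be * y + ga * (x ^ 2 - y ^ 2) + de * x * y.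

Lemma quad_harmonic (U : C -> Prop) (p : C) (c al be ga de : R) :
  harmonic_on U (fun l => c + quad al be ga de (fst l - fst p) (snd l - snd p)).
Proof.
  exists (fun l => al + 2 * ga * (fst l - fst p) + de * (snd l - snd p)),
    (fun l => be - 2 * ga * (snd l - snd p) + de * (fst l - fst p)),
    (fun _ => 2 * ga), (fun _ => de), (fun _ => de), (fun _ => - 2 * ga).
  split; [|repeat split; apply contC_on; intros; contC_auto].
  intros [x y] _; unfold quad; simpl.
  repeat split; try (apply is_derive_Reals; auto_derive; auto; ring); ring.
Qed.

Lemma quad_contC (p : C) (c al be ga de : R) (q : C) :
  contC (fun l => c + quad al be ga de (fst l - fst p) (snd l - snd p)) q.
Proof. unfold quad; contC_auto. Qed.

(* Failure of this predicate at [p] means that a strictly superharmonic quadratic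
   polynomial touches [f] from above at [p]. *)
Definition no_touch (U : C -> Prop) (f : C -> ER) : Prop :=
  forall p c al be ga de kap r0, f p = EFin c -> 0 < kap -> 0 < r0 ->
    ~ (forall x y, x ^ 2 + y ^ 2 < r0 ^ 2 -> U (fst p + x, snd p + y) /\
         ER_le (f (fst p + x, snd p + y))
               (EFin (c + quad al be ga de x y - kap * (x ^ 2 + y ^ 2)))).

(** On the circle of radius [r] about [p] the touching polynomial equals the harmonic polynomial
    [h], whose value at [p] is [c - kap r^2], less than [f p]. *)
Lemma subharmonic_no_touch U f : subharmonic_on U f -> no_touch U f.
Proof.
  intros [_ [_ Hh]] p c al be ga de kap r0 Hp Hk Hr H.
  set (r := r0 / 2). assert (Hr' : 0 < r < r0) by (unfold r; lra).
  set (h := fun l : C => (c - kap * r ^ 2) + quad al be ga de (fst l - fst p) (snd l - snd p)).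
  assert (E : forall l : C, l = (fst p + (fst l - fst p), snd p + (snd l - snd p))).
  { intros [x y]; simpl; f_equal; ring. }
  assert (Hs : forall l, Cdist l p <= r -> (fst l - fst p) ^ 2 + (snd l - snd p) ^ 2 < r0 ^ 2).
  { intros l Hl. apply (Cmod_le (fst l - fst p, snd l - snd p)) in Hl; [simpl fst in Hl; simpl snd in Hl; nra|lra]. }
  assert (Hc : ER_le (f p) (EFin (h p))).
  { apply (Hh p r h); try lra.
    - intros l Hl; rewrite (E l); apply H; auto.
    - apply contC_on; intros; apply quad_contC.
    - apply quad_harmonic.
    - intros l Hl. rewrite (E l).
      eapply ER_le_trans; [apply H, Hs; lra|]. rewrite <- E; simpl; unfold h.
      apply (Cmod_eq (fst l - fst p, snd l - snd p)) in Hl; [simpl fst in Hl; simpl snd in Hl|lra].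
      rewrite <- Hl. lra.
    - rewrite Cdist_refl; lra. }
  rewrite Hp in Hc; unfold h, quad in Hc; simpl in Hc.
  assert (0 < kap * r ^ 2) by (apply Rmult_lt_0_compat; [lra|apply pow_lt; lra]).
  replace (fst p - fst p) with 0 in Hc by ring; replace (snd p - snd p) with 0 in Hc by ring.
  simpl in *; lra.
Qed.

(* [g] agrees with a harmonic quadratic polynomial to second order at the origin; [al], [be]
   are its first partial derivatives there. *)
Definition harm2 (g : R -> R -> R) (al be : R) : Prop :=
  exists ga de, forall eps, 0 < eps -> exists r, 0 < r /\
    forall x y, x ^ 2 + y ^ 2 < r ^ 2 ->
      Rabs (g x y - g 0 0 - quad al be ga de x y) <= eps * (x ^ 2 + y ^ 2).

(** Half of [kap] pays for the remainder in the second-order expansion of [g]. *)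
Lemma no_touch_harm2 U f p c g al be kap r0 :
  no_touch U f -> f p = EFin c -> harm2 g al be -> 0 < kap -> 0 < r0 ->
  ~ (forall x y, x ^ 2 + y ^ 2 < r0 ^ 2 -> U (fst p + x, snd p + y) /\
       ER_le (f (fst p + x, snd p + y)) (EFin (c + (g x y - g 0 0) - kap * (x ^ 2 + y ^ 2)))).
Proof.
  intros Hf Hp [ga [de Hg]] Hk Hr0 H.
  destruct (Hg (kap / 2)) as [r [Hr Hg']]; [lra|].
  apply (Hf p c al be ga de (kap / 2) (Rmin r r0)); auto; [lra|now apply Rmin_glb_lt|].
  intros x y Hxy.
  assert (H0 : 0 < Rmin r r0) by now apply Rmin_glb_lt.
  pose proof (Rmin_l r r0); pose proof (Rmin_r r r0).
  destruct (H x y) as [HU1 HU2]; [nra|]; split; auto.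
  apply ER_le_trans with (1 := HU2); simpl.
  assert (Hq := Hg' x y ltac:(nra)); apply Rabs_le_between in Hq; lra.
Qed.

Lemma harm2_quad c al be ga de : harm2 (fun x y => c + quad al be ga de x y) al be.
Proof.
  exists ga, de; intros eps He; exists 1; split; [lra|]; intros x y _.
  unfold quad; match goal with |- Rabs ?a <= _ => replace a with 0 by ring end.
  rewrite Rabs_R0; apply Rmult_le_pos; nra.
Qed.

Lemma harm2_plus f g a b a' b' :
  harm2 f a b -> harm2 g a' b' -> harm2 (fun x y => f x y + g x y) (a + a') (b + b').
Proof.
  intros [ga [de Hf]] [ga' [de' Hg]]; exists (ga + ga'), (de + de'); intros eps He.
  destruct (Hf (eps / 2)) as [r [Hr Hf']]; [lra|].
  destruct (Hg (eps / 2)) as [r' [Hr' Hg']]; [lra|].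
  assert (H0 : 0 < Rmin r r') by now apply Rmin_glb_lt.
  exists (Rmin r r'); split; auto; intros x y Hxy.
  pose proof (Rmin_l r r'); pose proof (Rmin_r r r').
  specialize (Hf' x y ltac:(nra)); specialize (Hg' x y ltac:(nra)).
  apply Rabs_le_between in Hf', Hg'; apply Rabs_le_between; unfold quad in *; lra.
Qed.

Lemma harm2_scal k f a b : harm2 f a b -> harm2 (fun x y => k * f x y) (k * a) (k * b).
Proof.
  intros [ga [de Hf]]; exists (k * ga), (k * de); intros eps He.
  pose proof (Rabs_pos k).
  destruct (Hf (eps / (Rabs k + 1))) as [r [Hr Hf']]; [apply Rdiv_lt_0_compat; lra|].
  exists r; split; auto; intros x y Hxy; specialize (Hf' x y Hxy).
  replace (k * f x y - k * f 0 0 - quad (k * a) (k * b) (k * ga) (k * de) x y)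
    with (k * (f x y - f 0 0 - quad a b ga de x y)) by (unfold quad; ring).
  rewrite Rabs_mult.
  apply Rle_trans with (Rabs k * (eps / (Rabs k + 1) * (x ^ 2 + y ^ 2))).
  { now apply Rmult_le_compat_l. }
  replace (Rabs k * (eps / (Rabs k + 1) * (x ^ 2 + y ^ 2)))
    with (Rabs k / (Rabs k + 1) * (eps * (x ^ 2 + y ^ 2))) by (field; lra).
  rewrite <- (Rmult_1_l (eps * (x ^ 2 + y ^ 2))) at 2.
  apply Rmult_le_compat_r; [nra|].
  apply Rmult_le_reg_r with (Rabs k + 1); [lra|].
  unfold Rdiv; rewrite Rmult_assoc, Rinv_l; lra.
Qed.

(* The Laplacian of [m^2] is [2 |grad m|^2 + 2 m (Laplacian m)]. *)
Lemma harm2_sqr m : harm2 m 0 0 -> harm2 (fun x y => m x y ^ 2) 0 0.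
Proof.
  intros [ga [de Hm]]; exists (2 * m 0 0 * ga), (2 * m 0 0 * de); intros eps He.
  set (c := m 0 0) in *. set (K := Rabs ga + Rabs de + 1).
  pose proof (Rabs_pos c); pose proof (Rabs_pos ga); pose proof (Rabs_pos de).
  assert (HK : 1 <= K) by (unfold K; lra).
  destruct (Hm (Rmin 1 (eps / (4 * Rabs c + 1)))) as [r [Hr Hm']].
  { apply Rmin_glb_lt; [lra|]; apply Rdiv_lt_0_compat; lra. }
  set (e := Rmin 1 _) in *.
  assert (He1 : e <= 1) by apply Rmin_l.
  assert (He2 : e * (4 * Rabs c + 1) <= eps).
  { apply Rle_trans with (eps / (4 * Rabs c + 1) * (4 * Rabs c + 1)).
    - apply Rmult_le_compat_r; [lra|apply Rmin_r].
    - right; field; lra. }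
  assert (He0 : 0 < e).
  { apply Rmin_glb_lt; [lra|]; apply Rdiv_lt_0_compat; lra. }
  set (r' := Rmin r (Rmin 1 (eps / (2 * (K + 1) ^ 2)))).
  assert (Hr' : 0 < r').
  { repeat apply Rmin_glb_lt; try lra; apply Rdiv_lt_0_compat; [lra|]; nra. }
  exists r'; split; auto; intros x y Hxy.
  assert (Hr1 : r' <= r) by apply Rmin_l.
  assert (Hr2 : r' <= 1) by (eapply Rle_trans; [apply Rmin_r|apply Rmin_l]).
  assert (Hr3 : r' * (2 * (K + 1) ^ 2) <= eps).
  { apply Rle_trans with (eps / (2 * (K + 1) ^ 2) * (2 * (K + 1) ^ 2)).
    - apply Rmult_le_compat_r; [nra|]; eapply Rle_trans; [apply Rmin_r|apply Rmin_r].
    - right; field; nra. }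
  specialize (Hm' x y ltac:(nra)).
  set (s := x ^ 2 + y ^ 2) in *. assert (Hs : 0 <= s) by (unfold s; nra).
  set (R1 := m x y - c - quad 0 0 ga de x y) in *.
  assert (Hq : Rabs (quad 0 0 ga de x y) <= K * s).
  { unfold quad; rewrite !Rmult_0_l, !Rplus_0_l.
    eapply Rle_trans; [apply Rabs_triang|].
    rewrite Rmult_assoc, !Rabs_mult.
    assert (Rabs (x ^ 2 - y ^ 2) <= s) by (unfold s; apply Rabs_le; split; nra).
    assert (Rabs x * Rabs y <= s).
    { rewrite <- Rabs_mult; unfold s; apply Rabs_le; split; nra. }
    unfold K; nra. }
  (* The first summand is linear in the remainder [R1]; the second is at most [((K + 1) s)^2], where
     one factor [s <= r'] makes it small compared with [s]. *)
  replace (m x y ^ 2 - c ^ 2 - quad 0 0 (2 * c * ga) (2 * c * de) x y)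
    with (2 * c * R1 + (R1 + quad 0 0 ga de x y) ^ 2) by (unfold R1, quad; ring).
  assert (H2 : Rabs (R1 + quad 0 0 ga de x y) <= (K + 1) * s).
  { eapply Rle_trans; [apply Rabs_triang|]; nra. }
  eapply Rle_trans; [apply Rabs_triang|].
  rewrite Rabs_mult, (Rabs_mult 2), (Rabs_right 2) by lra.
  rewrite <- RPow_abs.
  pose proof (Rabs_pos (R1 + quad 0 0 ga de x y)).
  assert (Hsr : s <= r').
  { assert (r' ^ 2 <= r') by nra; lra. }
  assert (Rabs (R1 + quad 0 0 ga de x y) ^ 2 <= (eps / 2) * s).
  { apply Rle_trans with (((K + 1) * s) ^ 2); [apply pow_incr; lra|].
    replace (((K + 1) * s) ^ 2) with ((K + 1) ^ 2 * s * s) by ring.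
    apply Rmult_le_compat_r; auto.
    assert ((K + 1) ^ 2 * s <= (K + 1) ^ 2 * r') by (apply Rmult_le_compat_l; nra). lra. }
  assert (2 * Rabs c * Rabs R1 <= (eps / 2) * s).
  { apply Rle_trans with (2 * Rabs c * (e * s)); [apply Rmult_le_compat_l; nra|].
    replace (2 * Rabs c * (e * s)) with (2 * Rabs c * e * s) by ring.
    apply Rmult_le_compat_r; nra. }
  lra.
Qed.

Lemma mean_value_bound (f f' : R -> R) (x b M : R) :
  (forall t, Rabs (t - x) <= Rabs b -> derivable_pt_lim f t (f' t) /\ Rabs (f' t) <= M) ->
  Rabs (f (x + b) - f x) <= M * Rabs b.
Proof.
  intros H.
  assert (Hin : forall c, Rmin x (x + b) <= c <= Rmax x (x + b) -> Rabs (c - x) <= Rabs b).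
  { intros c; unfold Rmin, Rmax; destruct Rle_dec; unfold Rabs; repeat destruct Rcase_abs; lra. }
  destruct (MVT_abs f f' x (x + b)) as [c [Hc1 Hc2]].
  { intros c Hc; now apply H, Hin. }
  rewrite Hc1. replace (x + b - x) with b by ring.
  apply Rmult_le_compat_r; [apply Rabs_pos|]; now apply H, Hin.
Qed.

(** The mean value inequality is applied to [f'] minus a linear function and then to [f] minus a
    quadratic one. The error is measured by the oscillation of [f''] about [l], so continuity of the
    second derivatives will suffice. *)
Lemma taylor2_bound (f f' f'' : R -> R) (x b l e : R) :
  (forall t, Rabs (t - x) <= Rabs b ->
     derivable_pt_lim f t (f' t) /\ derivable_pt_lim f' t (f'' t) /\ Rabs (f'' t - l) <= e) ->
  Rabs (f (x + b) - f x - f' x * b - l / 2 * b ^ 2) <= e * b ^ 2.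
Proof.
  intros H.
  assert (H1 : forall t, Rabs (t - x) <= Rabs b ->
            Rabs (f' t - f' x - l * (t - x)) <= e * Rabs b).
  { intros t Ht.
    assert (Hm := mean_value_bound (fun s => f' s - l * s) (fun s => f'' s - l) x (t - x) e).
    cbv beta in Hm; replace (x + (t - x)) with t in Hm by ring.
    replace (f' t - f' x - l * (t - x)) with (f' t - l * t - (f' x - l * x)) by ring.
    apply Rle_trans with (e * Rabs (t - x)).
    - apply Hm; intros s Hs. destruct (H s) as [_ [H2 H3]]; [lra|]; split; auto.
      apply is_derive_Reals in H2; apply is_derive_Reals.
      apply (is_derive_minus f' (fun s => l * s)); auto. auto_derive; auto; ring.
    - destruct (H x) as [_ [_ H3]].
      { replace (x - x) with 0 by ring; rewrite Rabs_R0; apply Rabs_pos. }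
      pose proof (Rabs_pos (f'' x - l)); apply Rmult_le_compat_l; lra. }
  assert (Hm := mean_value_bound (fun s => f s - (f' x * (s - x) + l / 2 * (s - x) ^ 2))
                  (fun s => f' s - f' x - l * (s - x)) x b (e * Rabs b)).
  cbv beta in Hm.
  replace (f (x + b) - f x - f' x * b - l / 2 * b ^ 2)
    with (f (x + b) - (f' x * (x + b - x) + l / 2 * (x + b - x) ^ 2) -
           (f x - (f' x * (x - x) + l / 2 * (x - x) ^ 2))) by field.
  replace (e * b ^ 2) with (e * Rabs b * Rabs b).
  2:{ rewrite <- (pow2_abs b); ring. }
  apply Hm; intros t Ht; split; [|now apply H1].
  destruct (H t Ht) as [H2 _].
  apply is_derive_Reals in H2; apply is_derive_Reals.
  replace (f' t - f' x - l * (t - x)) with (f' t - (f' x + l * (t - x))) by ring.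
  apply (is_derive_minus f (fun s => f' x * (s - x) + l / 2 * (s - x) ^ 2)); auto.
  auto_derive; auto; field.
Qed.

(** The increment is split into a horizontal and a vertical step. The vertical slope at the shifted
    point is compared with [hy p] through [hyx], and the Laplace equation turns [hyy p] into
    [- hxx p], so the quadratic part is trace-free. *)
Lemma harmonic_harm2 (U : C -> Prop) (h : C -> R) (p : C) (r0 : R) :
  0 < r0 -> (forall q, Cdist q p < r0 -> U q) -> harmonic_on U h ->
  exists al be, harm2 (fun x y => h (fst p + x, snd p + y)) al be /\
    derivable_pt_lim (fun t => h (t, snd p)) (fst p) al /\
    derivable_pt_lim (fun t => h (fst p, t)) (snd p) be.
Proof.
  intros Hr0 HU [hx [hy [hxx [hxy [hyx [hyy [Hd [cxx [_ [cyx cyy]]]]]]]]]].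
  assert (Up : U p) by (apply HU; rewrite Cdist_refl; lra).
  destruct (Hd p Up) as [Dx [Dy [_ [_ [_ [_ Hlap]]]]]].
  exists (hx p), (hy p); split; [|auto].
  exists (hxx p / 2), (hyx p); intros eps He.
  destruct (cxx p Up (eps / 4)) as [r1 [Hr1 C1]]; [lra|].
  destruct (cyx p Up (eps / 4)) as [r2 [Hr2 C2]]; [lra|].
  destruct (cyy p Up (eps / 4)) as [r3 [Hr3 C3]]; [lra|].
  set (r := Rmin r0 (Rmin r1 (Rmin r2 r3))).
  assert (Hr : 0 < r) by (repeat apply Rmin_glb_lt; auto).
  assert (L0 : r <= r0) by apply Rmin_l.
  assert (L1 : r <= r1) by (eapply Rle_trans; [apply Rmin_r|apply Rmin_l]).
  assert (L2 : r <= r2).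
  { eapply Rle_trans; [apply Rmin_r|]; eapply Rle_trans; [apply Rmin_r|apply Rmin_l]. }
  assert (L3 : r <= r3).
  { eapply Rle_trans; [apply Rmin_r|]; eapply Rle_trans; [apply Rmin_r|apply Rmin_r]. }
  exists r; split; auto. intros a b Hab.
  destruct p as [x y]; cbn [fst snd] in *.
  assert (Hin : forall s t, Rabs (s - x) <= Rabs a -> Rabs (t - y) <= Rabs b ->
            Cdist (s, t) (x, y) < r).
  { intros s t Hs Ht; apply Cmod_lt; [lra|]; cbn [fst snd].
    apply Rle_lt_trans with (2 := Hab); rewrite <- (pow2_abs a), <- (pow2_abs b),
      <- (pow2_abs (s - x)), <- (pow2_abs (t - y)).
    apply Rplus_le_compat; apply pow_incr; split; auto; apply Rabs_pos. }
  assert (Z : forall u v, Rabs (u - u) <= Rabs v).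
  { intros u v; replace (u - u) with 0 by ring; rewrite Rabs_R0; apply Rabs_pos. }
  assert (Hxa : Rabs (x + a - x) <= Rabs a) by (right; f_equal; ring).
  assert (T1 := taylor2_bound (fun s => h (s, y)) (fun s => hx (s, y)) (fun s => hxx (s, y))
                  x a (hxx (x, y)) (eps / 4)).
  cbv beta in T1.
  assert (T2 := taylor2_bound (fun t => h (x + a, t)) (fun t => hy (x + a, t))
                  (fun t => hyy (x + a, t)) y b (hyy (x, y)) (eps / 4)).
  cbv beta in T2.
  assert (T3 := mean_value_bound (fun s => hy (s, y) - hyx (x, y) * s)
                  (fun s => hyx (s, y) - hyx (x, y)) x a (eps / 4)).
  cbv beta in T3.
  assert (U1 : Rabs (h (x + a, y) - h (x, y) - hx (x, y) * a - hxx (x, y) / 2 * a ^ 2)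
               <= eps / 4 * a ^ 2).
  { apply T1; intros s Hs; assert (Hd' := Hin s y Hs (Z y b)).
    destruct (Hd (s, y)) as [E1 [_ [E2 _]]]; [apply HU; lra|]; cbn [fst snd] in *.
    repeat split; auto; apply Rlt_le, C1; [apply HU|]; lra. }
  assert (U2 : Rabs (h (x + a, y + b) - h (x + a, y) - hy (x + a, y) * b
                     - hyy (x, y) / 2 * b ^ 2) <= eps / 4 * b ^ 2).
  { apply T2; intros t Ht; assert (Hd' := Hin (x + a) t Hxa Ht).
    destruct (Hd (x + a, t)) as [_ [E1 [_ [_ [_ [E2 _]]]]]]; [apply HU; lra|]; cbn [fst snd] in *.
    repeat split; auto; apply Rlt_le, C3; [apply HU|]; lra. }
  assert (U3 : Rabs (hy (x + a, y) - hyx (x, y) * (x + a) - (hy (x, y) - hyx (x, y) * x))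
               <= eps / 4 * Rabs a).
  { apply T3; intros s Hs; assert (Hd' := Hin s y Hs (Z y b)).
    destruct (Hd (s, y)) as [_ [_ [_ [_ [E1 _]]]]]; [apply HU; lra|]; cbn [fst snd] in *.
    split; [|apply Rlt_le, C2; [apply HU|]; lra].
    apply is_derive_Reals in E1; apply is_derive_Reals.
    apply (is_derive_minus (fun s => hy (s, y)) (fun s => hyx (x, y) * s)); auto.
    auto_derive; auto; ring. }
  clear T1 T2 T3.
  assert (U4 : Rabs ((hy (x + a, y) - hyx (x, y) * (x + a) - (hy (x, y) - hyx (x, y) * x)) * b)
               <= eps / 4 * (a ^ 2 + b ^ 2)).
  { rewrite Rabs_mult.
    apply Rle_trans with (eps / 4 * Rabs a * Rabs b);
      [apply Rmult_le_compat_r; [apply Rabs_pos|auto]|].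
    rewrite Rmult_assoc; apply Rmult_le_compat_l; [lra|].
    rewrite <- (pow2_abs a), <- (pow2_abs b); pose proof (Rabs_pos a); pose proof (Rabs_pos b).
    nra. }
  rewrite !Rplus_0_r. unfold quad.
  apply Rabs_le_between in U1, U2, U4; apply Rabs_le_between.
  replace (hyy (x, y)) with (- hxx (x, y)) in * by lra.
  pose proof (pow2_ge_0 a); pose proof (pow2_ge_0 b).
  assert (0 <= eps * a ^ 2) by (apply Rmult_le_pos; lra).
  assert (0 <= eps * b ^ 2) by (apply Rmult_le_pos; lra).
  split; nra.
Qed.

(** The substitution is multiplication by [u + i v], and a complex linear change of variable
    preserves harmonic quadratic polynomials. *)
Lemma harm2_mul g al be u v : harm2 g al be ->
  harm2 (fun x y => g (x * u - y * v) (x * v + y * u)) (al * u + be * v) (be * u - al * v).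
Proof.
  intros [ga [de Hg]].
  exists (ga * (u ^ 2 - v ^ 2) + de * u * v), (de * (u ^ 2 - v ^ 2) - 4 * ga * u * v).
  intros eps He. set (m := u ^ 2 + v ^ 2). assert (Hm : 0 <= m) by (unfold m; nra).
  destruct (Hg (eps / (m + 1))) as [r [Hr Hg']]; [apply Rdiv_lt_0_compat; lra|].
  exists (r / (m + 1)); split; [apply Rdiv_lt_0_compat; lra|]; intros x y Hxy.
  assert (E : (x * u - y * v) ^ 2 + (x * v + y * u) ^ 2 = m * (x ^ 2 + y ^ 2))
    by (unfold m; ring).
  assert (Hs : 0 <= x ^ 2 + y ^ 2) by nra.
  assert (Hi : 0 < / (m + 1)) by (apply Rinv_0_lt_compat; lra).
  assert (Hmi : m * / (m + 1) <= 1).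
  { apply Rmult_le_reg_r with (m + 1); [lra|]; rewrite Rmult_assoc, Rinv_l; lra. }
  assert (Hmi1 : / (m + 1) <= 1).
  { apply Rmult_le_reg_r with (m + 1); [lra|]; rewrite Rinv_l; lra. }
  specialize (Hg' (x * u - y * v) (x * v + y * u)); rewrite E in Hg'.
  replace (0 * u - 0 * v) with 0 by ring; replace (0 * v + 0 * u) with 0 by ring.
  replace (quad (al * u + be * v) (be * u - al * v) (ga * (u ^ 2 - v ^ 2) + de * u * v)
             (de * (u ^ 2 - v ^ 2) - 4 * ga * u * v) x y)
    with (quad al be ga de (x * u - y * v) (x * v + y * u)) by (unfold quad; ring).
  eapply Rle_trans; [apply Hg'|].
  - apply Rle_lt_trans with (m * (r / (m + 1)) ^ 2); [apply Rmult_le_compat_l; lra|].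
    replace (m * (r / (m + 1)) ^ 2) with (m * / (m + 1) * (r ^ 2 * / (m + 1))) by (field; lra).
    destruct (Req_dec m 0) as [->|Hm0]; [rewrite !Rmult_0_l; apply pow_lt; lra|].
    assert (m * / (m + 1) < 1).
    { apply Rmult_lt_reg_r with (m + 1); [lra|]; rewrite Rmult_assoc, Rinv_l; lra. }
    assert (0 < r ^ 2) by (apply pow_lt; lra).
    assert (0 < r ^ 2 * / (m + 1) <= r ^ 2) by nra.
    assert (0 <= m * / (m + 1)) by nra. nra.
  - replace (eps / (m + 1) * (m * (x ^ 2 + y ^ 2)))
      with (m * / (m + 1) * (eps * (x ^ 2 + y ^ 2))) by (field; lra).
    rewrite <- (Rmult_1_l (eps * (x ^ 2 + y ^ 2))) at 2.
    apply Rmult_le_compat_r; nra.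
Qed.

(** [log |l|] through the squared modulus, so that its derivatives off the origin are rational
    functions. *)
Definition logmod (l : C) : R := / 2 * ln (fst l ^ 2 + snd l ^ 2).

Lemma logmod_ln (l : C) : 0 < Cmod l -> logmod l = ln (Cmod l).
Proof.
  intros H; unfold logmod; rewrite <- Cmod_sqr.
  replace (Cmod l ^ 2) with (Cmod l * Cmod l) by ring; rewrite ln_mult; auto; field.
Qed.

Lemma exp_logmod (l : C) : 0 < Cmod l -> exp (logmod l) = Cmod l.
Proof. intros H; rewrite logmod_ln, exp_ln; auto. Qed.

Lemma logmod_exp (l : C) (t : R) : Cmod l = exp t -> logmod l = t.
Proof. intros H; rewrite logmod_ln; rewrite H; [apply ln_exp|apply exp_pos]. Qed.

Lemma logmod_contC (p : C) : 0 < Cmod p -> contC logmod p.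
Proof.
  intros H. unfold logmod; apply contC_mult; [contC_auto|]; apply contC_ln; [contC_auto|].
  rewrite <- Cmod_sqr; now apply pow_lt.
Qed.

Lemma logmod_harmonic : harmonic_on (fun l => 0 < Cmod l) logmod.
Proof.
  set (q := fun l : C => fst l ^ 2 + snd l ^ 2).
  assert (Hq : forall l, 0 < Cmod l -> 0 < q l).
  { intros l Hl; unfold q; rewrite <- Cmod_sqr; now apply pow_lt. }
  exists (fun l => fst l * / q l), (fun l => snd l * / q l),
    (fun l => (snd l ^ 2 - fst l ^ 2) * / q l ^ 2), (fun l => - 2 * fst l * snd l * / q l ^ 2),
    (fun l => - 2 * fst l * snd l * / q l ^ 2), (fun l => (fst l ^ 2 - snd l ^ 2) * / q l ^ 2).
  split.
  - intros l Hl; specialize (Hq l Hl); unfold q, logmod in *; destruct l as [x y]; cbn [fst snd] in *.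
    repeat split; try (apply is_derive_Reals; auto_derive; repeat split; auto; try lra;
       try (apply Rgt_not_eq; lra); field; lra). field; lra.
  - assert (cq : forall l, contC q l) by (intros; unfold q; contC_auto).
    repeat split; apply contC_on; intros l Hl; specialize (Hq l Hl);
    (apply contC_mult; [contC_auto|apply (contC_Rinv (fun l => q l ^ 2));
       [apply contC_pow; auto|apply pow_nonzero; lra]]).
Qed.

(* The derivative of [logmod] at a nonzero point is injective, so a complex direction
   [(u, v)] can be chosen along which it has any prescribed gradient. *)
Lemma logmod_harm2 (p : C) (al be : R) : 0 < Cmod p ->
  exists u v, u ^ 2 + v ^ 2 = (al ^ 2 + be ^ 2) * Cmod p ^ 2 /\
    harm2 (fun x y => logmod (fst p + (x * u - y * v), snd p + (x * v + y * u))) al be.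
Proof.
  intros Hp.
  destruct (harmonic_harm2 (fun l => 0 < Cmod l) logmod p (Cmod p) Hp) with (2 := logmod_harmonic)
    as [a [b [Hh [Da Db]]]].
  { intros q Hq. pose proof (Cdist_triangle p q (0, 0)).
    rewrite !Cdist_0, (Cdist_sym p q) in *; lra. }
  set (m := fst p ^ 2 + snd p ^ 2).
  assert (Hm : 0 < m) by (unfold m; rewrite <- Cmod_sqr; now apply pow_lt).
  assert (Ea : a = fst p / m).
  { apply (uniqueness_limite _ _ _ _ Da), is_derive_Reals; unfold logmod; cbn [fst snd].
    unfold m in *; auto_derive; [lra|field; lra]. }
  assert (Eb : b = snd p / m).
  { apply (uniqueness_limite _ _ _ _ Db), is_derive_Reals; unfold logmod; cbn [fst snd].
    unfold m in *; auto_derive; [lra|field; lra]. }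
  (* [u + i v = p (al - i be)]: as the derivative of the logarithm is [1 / p], the linear part is
     the real part of [(u + i v)(x + i y) / p], which is [al x + be y]. *)
  exists (fst p * al + snd p * be), (snd p * al - fst p * be).
  split; [rewrite Cmod_sqr; ring|].
  apply harm2_mul with (u := fst p * al + snd p * be) (v := snd p * al - fst p * be) in Hh.
  assert (E1 : a * (fst p * al + snd p * be) + b * (snd p * al - fst p * be) = al)
    by (rewrite Ea, Eb; unfold m in *; field; lra).
  assert (E2 : b * (fst p * al + snd p * be) - a * (snd p * al - fst p * be) = be)
    by (rewrite Ea, Eb; unfold m in *; field; lra).
  rewrite E1, E2 in Hh; exact Hh.
Qed.

(** * Plurisubharmonicity through touching quadratic polynomials *)

Lemma usc_on_C_in (U K : C -> Prop) (f : C -> ER) :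
  (forall l, K l -> U l) -> usc_on_C U f -> usc_in nearC K f.
Proof.
  intros KU uf l k Kl Hk.
  destruct (proj1 (limsup_le_iff _ _ _ _) (uf l (KU l Kl)) k Hk) as [r [Hr H]].
  exists r; split; auto.
Qed.

(** At an interior maximum of [f - h + e |l - c|^2] the function [h - e |l - c|^2], up to a
    constant, touches [f] from above, which is excluded. *)
Lemma no_touch_subharmonic (U : C -> Prop) (f : C -> ER) :
  (forall l, U l -> f l <> PInf) -> usc_on_C U f -> no_touch U f -> subharmonic_on U f.
Proof.
  intros fin uf Hf; split; [auto|split; [auto|]].
  intros c r h Hr HU hc hh hb l0 Hl0. apply NNPP; intro Hn.
  destruct (f l0) as [|c0|] eqn:E0; [apply Hn; simpl; auto| |apply (fin l0); auto; apply HU; lra].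
  simpl in Hn; apply Rnot_le_lt in Hn.
  (* With [e r^2] equal to half the excess of [f] over [h] at [l0], the perturbation is too small to
     move the maximum to the boundary circle. *)
  set (e := (c0 - h l0) / (2 * r ^ 2)).
  assert (Hr2 : 0 < r ^ 2) by (apply pow_lt; lra).
  assert (He : 0 < e) by (apply Rdiv_lt_0_compat; lra).
  assert (Her : e * r ^ 2 = (c0 - h l0) / 2) by (unfold e; field; lra).
  set (K := fun l => 0 <= Cdist l c <= r).
  assert (HK : forall l, Cdist l c <= r -> K l).
  { intros l Hl; split; auto; apply Cmod_ge0. }
  set (g := fun l => - h l + e * Cdist l c ^ 2).
  destruct (usc_attains_max nearC K (fun l => ER_addR (f l) (g l))) as [p [Kp Hp]].
  - apply compact_annulus.
  - apply usc_in_addR; [apply nearC_mono| |].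
    + apply usc_on_C_in with U; auto; intros l [_ Hl]; auto.
    + intros q eps [_ Kq] Heps.
      destruct (hc q Kq (eps / 2)) as [d [Hd Hd']]; [lra|].
      destruct (contC_mult (fun _ => e) (fun l => Cdist l c ^ 2) q
                  (contC_const _ _) (contC_pow _ 2 _ (contC_Cdist _ _)) (eps / 2))
        as [d' [Hd1 Hd2]]; [lra|].
      exists (Rmin d d'); split; [now apply Rmin_glb_lt|]; intros y [_ Ky] Ny.
      unfold nearC in Ny; pose proof (Rmin_l d d'); pose proof (Rmin_r d d').
      specialize (Hd' y Ky ltac:(lra)); specialize (Hd2 y ltac:(lra)).
      unfold g; apply Rabs_def2 in Hd'; apply Rabs_def2 in Hd2; apply Rabs_def1; lra.
  - intros l [_ Hl] Hi; apply (fin l); auto; destruct (f l); auto; discriminate.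
  - exists l0; apply HK; lra.
  - assert (H0 := Hp l0 (HK l0 ltac:(lra))); rewrite E0 in H0.
    destruct (f p) as [|cp|] eqn:Ep; simpl in H0; try contradiction.
    2:{ destruct Kp; apply (fin p); auto. }
    assert (Hlp : Cdist p c < r).
    { destruct Kp as [_ [Hlt|Heq]]; auto. exfalso.
      specialize (hb p Heq); rewrite Ep in hb; simpl in hb; unfold g in H0; rewrite Heq in H0.
      assert (0 <= e * Cdist l0 c ^ 2) by (apply Rmult_le_pos; [lra|apply pow2_ge_0]); lra. }
    destruct (harmonic_harm2 (Cdisk c r) h p (r - Cdist p c)) as [al [be [Hh _]]]; auto; [lra| |].
    { intros q Hq; unfold Cdisk; pose proof (Cdist_triangle q p c); lra. }
    apply (no_touch_harm2 U f p cp
             (fun x y => h (fst p + x, snd p + y) +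
                (0 + quad (- 2 * e * (fst p - fst c)) (- 2 * e * (snd p - snd c)) 0 0 x y))
             _ _ e (r - Cdist p c) Hf Ep (harm2_plus _ _ _ _ _ _ Hh (harm2_quad _ _ _ _ _)) He);
      [lra|].
    intros x y Hxy.
    set (q := (fst p + x, snd p + y)).
    assert (Hq : Cdist q c <= r).
    { pose proof (Cdist_triangle q p c).
      assert (Cdist q p < r - Cdist p c); [|lra].
      apply Cmod_lt; [lra|]; unfold q; cbn [fst snd].
      eapply Rle_lt_trans; [|exact Hxy]; right; ring. }
    split; [auto|]. specialize (Hp q (HK q Hq)); cbv beta in Hp.
    unfold g in Hp; unfold Cdist in Hp; rewrite !Cmod_sqr in Hp; cbn [fst snd] in Hp.
    replace (fst p + 0, snd p + 0) with p by (destruct p; simpl; f_equal; ring).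
    destruct (f q); simpl in Hp |- *; auto; unfold q, quad in *; cbn [fst snd] in *; nra.
Qed.

Lemma Cn_bound {m : nat} (B : Cn m) : exists M, 0 < M /\ forall i, Cmod (B i) <= M.
Proof.
  induction m as [|k IH].
  - exists 1; split; [lra|]; intros i; inversion i.
  - destruct (IH (fun i => B (Fin.FS i))) as [M [HM H]].
    pose proof (Cmod_ge0 (B Fin.F1)).
    exists (M + Cmod (B Fin.F1)); split; [lra|].
    intros i; apply (Fin.caseS' i); [lra|].
    intros j; specialize (H j); cbv beta in H; lra.
Qed.

Section Lines.
Context {m : nat}.
Implicit Types (Om : Cn m -> Prop) (u : Cn m -> ER) (A B : Cn m).

Definition line A B (x y : R) : Cn m := Cn_add A (Cn_scal (x, y) B).

Lemma line_0 A B : line A B 0 0 = A.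
Proof.
  extensionality i; unfold line, Cn_add, Cn_scal, Cadd, Cmul; destruct (A i); simpl; f_equal; ring.
Qed.

Lemma line_line A B p x y :
  Cn_add A (Cn_scal (fst p + x, snd p + y) B) = line (Cn_add A (Cn_scal p B)) B x y.
Proof.
  extensionality i; unfold line, Cn_add, Cn_scal, Cadd, Cmul; simpl; f_equal; ring.
Qed.

Definition psh_no_touch Om u : Prop :=
  forall A B c al be ga de kap r0, u A = EFin c -> 0 < kap -> 0 < r0 ->
    ~ (forall x y, x ^ 2 + y ^ 2 < r0 ^ 2 -> Om (line A B x y) /\
         ER_le (u (line A B x y))
               (EFin (c + quad al be ga de x y - kap * (x ^ 2 + y ^ 2)))).

(** Both maximum principle arguments for [Phi] use this form: the test function along the line need
    only agree to second order with a harmonic polynomial. *)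
Lemma psh_touch_harm2 Om u A B c g al be kap r0 :
  psh_on Om u -> u A = EFin c -> harm2 g al be -> 0 < kap -> 0 < r0 ->
  ~ (forall x y, x ^ 2 + y ^ 2 < r0 ^ 2 -> Om (line A B x y) /\
       ER_le (u (line A B x y)) (EFin (c + (g x y - g 0 0) - kap * (x ^ 2 + y ^ 2)))).
Proof.
  intros [_ [_ Hs]] Hu Hg Hk Hr H.
  apply (no_touch_harm2 _ _ (0, 0) c g al be kap r0
           (subharmonic_no_touch _ _ (Hs A B))); auto.
  - change (Cn_add A (Cn_scal (0, 0) B)) with (line A B 0 0); now rewrite line_0.
  - cbn [fst snd]; intros x y Hxy; rewrite !Rplus_0_l; now apply H.
Qed.

Lemma ballN_line A B : exists M, 0 < M /\ forall p q r, 0 < r -> Cdist q p < r / M ->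
  ballN (Cn_add A (Cn_scal p B)) r (Cn_add A (Cn_scal q B)).
Proof.
  destruct (Cn_bound B) as [M [HM H]]; exists M; split; auto.
  intros p q r Hr Hq i.
  replace (Cdist _ _) with (Cdist q p * Cmod (B i)).
  - pose proof (Cmod_ge0 (B i)); pose proof (Cmod_ge0 (fst q - fst p, snd q - snd p)).
    apply Rle_lt_trans with (Cdist q p * M).
    + apply Rmult_le_compat_l; auto.
    + apply Rmult_lt_reg_r with (/ M); [now apply Rinv_0_lt_compat|].
      rewrite Rmult_assoc, Rinv_r, Rmult_1_r; [exact Hq|lra].
  - unfold Cdist at 1; rewrite <- Cmod_mul; unfold Cdist; f_equal.
    unfold Cn_add, Cn_scal, Cadd, Cmul; simpl; f_equal; ring.
Qed.

Lemma usc_on_iff Om u : usc_on Om u <->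
  forall z k, Om z -> ~ ER_le (EFin k) (u z) ->
    exists r, 0 < r /\ forall x, Om x -> ballN z r x -> ER_le (u x) (EFin k).
Proof.
  split.
  - intros Hu z k Oz. now apply limsup_le_iff, Hu.
  - intros H z Oz; apply limsup_le_iff; auto.
Qed.

Lemma usc_line Om u A B : usc_on Om u ->
  usc_on_C (fun l => Om (Cn_add A (Cn_scal l B))) (fun l => u (Cn_add A (Cn_scal l B))).
Proof.
  intros Hu l Ol; apply limsup_le_iff; intros k Hk.
  destruct (proj1 (usc_on_iff _ _) Hu _ k Ol Hk) as [r [Hr H]].
  destruct (ballN_line A B) as [M [HM HB]].
  exists (r / M); split; [now apply Rdiv_lt_0_compat|].
  intros q Oq Nq; auto.
Qed.

Lemma no_touch_psh Om u :
  (forall z, Om z -> u z <> PInf) -> usc_on Om u -> psh_no_touch Om u -> psh_on Om u.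
Proof.
  intros fin uu Hu; split; [auto|split; [auto|]]; intros A B.
  apply no_touch_subharmonic; [auto|now apply usc_line|].
  intros p c al be ga de kap r0 Hp Hk Hr H.
  apply (Hu (Cn_add A (Cn_scal p B)) B c al be ga de kap r0); auto.
  intros x y Hxy; rewrite <- line_line; now apply H.
Qed.

End Lines.

(** * Harmonic polynomials on the unit disc *)

(** Summing over the four points at distance [t] along the axes cancels every trace-free quadratic
    and leaves [kap t^2] against a remainder of at most [kap t^2 / 2]. *)
Lemma harm2_no_touch (g : C -> R) :
  (forall p, exists al be, harm2 (fun x y => g (fst p + x, snd p + y)) al be) ->
  no_touch (fun _ => True) (fun l => EFin (g l)).
Proof.
  intros Hg p c al be ga de kap r0 Hp Hk Hr H. injection Hp as Hp.
  destruct (Hg p) as [a [b [ga' [de' Hh]]]]; destruct (Hh (kap / 2)) as [r [Hr' Hh']]; [lra|].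
  rewrite !Rplus_0_r, <- surjective_pairing, Hp in Hh'.
  set (t := Rmin r r0 / 2).
  assert (0 < Rmin r r0) by now apply Rmin_glb_lt.
  pose proof (Rmin_l r r0); pose proof (Rmin_r r r0).
  assert (Ht : 0 < t) by (unfold t; lra).
  assert (Htr : t ^ 2 < r ^ 2) by (unfold t; nra).
  assert (Htr0 : t ^ 2 < r0 ^ 2) by (unfold t; nra).
  assert (Ht2 : 0 < kap * t ^ 2) by (apply Rmult_lt_0_compat; [lra|apply pow_lt; lra]).
  assert (B1 := Hh' t 0 ltac:(lra)); assert (B2 := Hh' (- t) 0 ltac:(lra)).
  assert (B3 := Hh' 0 t ltac:(lra)); assert (B4 := Hh' 0 (- t) ltac:(lra)).
  destruct (H t 0 ltac:(lra)) as [_ D1]; destruct (H (- t) 0 ltac:(lra)) as [_ D2].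
  destruct (H 0 t ltac:(lra)) as [_ D3]; destruct (H 0 (- t) ltac:(lra)) as [_ D4].
  simpl ER_le in D1, D2, D3, D4; unfold quad in *.
  apply Rabs_le_between in B1, B2, B3, B4. lra.
Qed.

Fixpoint zpow (k : nat) (l : C) : C :=
  match k with O => (1, 0) | S j => Cmul l (zpow j l) end.

Inductive harmonic_poly : (C -> R) -> Prop :=
| hp_re k : harmonic_poly (fun l => fst (zpow k l))
| hp_im k : harmonic_poly (fun l => snd (zpow k l))
| hp_plus f g : harmonic_poly f -> harmonic_poly g -> harmonic_poly (fun l => f l + g l)
| hp_scal c f : harmonic_poly f -> harmonic_poly (fun l => c * f l).

Lemma hp_const c : harmonic_poly (fun _ => c).
Proof.
  replace (fun _ : C => c) with (fun l : C => c * fst (zpow 0 l)).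
  - apply hp_scal, hp_re.
  - extensionality l; simpl; ring.
Qed.

Lemma zpow_deriv k x y :
  derivable_pt_lim (fun t => fst (zpow k (t, y))) x (INR k * fst (zpow (pred k) (x, y))) /\
  derivable_pt_lim (fun t => snd (zpow k (t, y))) x (INR k * snd (zpow (pred k) (x, y))) /\
  derivable_pt_lim (fun t => fst (zpow k (x, t))) y (- INR k * snd (zpow (pred k) (x, y))) /\
  derivable_pt_lim (fun t => snd (zpow k (x, t))) y (INR k * fst (zpow (pred k) (x, y))).
Proof.
  induction k as [|k [H1 [H2 [H3 H4]]]].
  - simpl; repeat split; apply is_derive_Reals; auto_derive; auto; ring.
  (* The factor [INR k] makes this true for [k = 0] as well, where [pred k] is again [0]. *)
  - assert (E : forall l : C, INR k * fst (zpow k l) =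
                INR k * (fst l * fst (zpow (pred k) l) - snd l * snd (zpow (pred k) l)) /\
                INR k * snd (zpow k l) =
                INR k * (fst l * snd (zpow (pred k) l) + snd l * fst (zpow (pred k) l))).
    { intros l; destruct k; simpl; split; ring. }
    destruct (E (x, y)) as [E1 E2]; clear E; cbn [fst snd] in E1, E2.
    rewrite S_INR; cbn [pred zpow Cmul fst snd].
    assert (M : forall (f : R -> R) t d, derivable_pt_lim f t d ->
              derivable_pt_lim (fun s => s * f s) t (1 * f t + t * d)).
    { intros f t d Hf; apply (derivable_pt_lim_mult id f); auto; apply derivable_pt_lim_id. }
    repeat split.
    + replace ((INR k + 1) * fst (zpow k (x, y))) with
        (1 * fst (zpow k (x, y)) + x * (INR k * fst (zpow (pred k) (x, y))) -
         y * (INR k * snd (zpow (pred k) (x, y)))) by lra.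
      apply (derivable_pt_lim_minus (fun t => t * fst (zpow k (t, y)))
               (fun t => y * snd (zpow k (t, y)))).
      * now apply (M (fun t => fst (zpow k (t, y)))).
      * now apply (derivable_pt_lim_scal (fun t => snd (zpow k (t, y)))).
    + replace ((INR k + 1) * snd (zpow k (x, y))) with
        (1 * snd (zpow k (x, y)) + x * (INR k * snd (zpow (pred k) (x, y))) +
         y * (INR k * fst (zpow (pred k) (x, y)))) by lra.
      apply (derivable_pt_lim_plus (fun t => t * snd (zpow k (t, y)))
               (fun t => y * fst (zpow k (t, y)))).
      * now apply (M (fun t => snd (zpow k (t, y)))).
      * now apply (derivable_pt_lim_scal (fun t => fst (zpow k (t, y)))).
    + replace (- (INR k + 1) * snd (zpow k (x, y))) with
        (x * (- INR k * snd (zpow (pred k) (x, y))) -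
         (1 * snd (zpow k (x, y)) + y * (INR k * fst (zpow (pred k) (x, y))))) by lra.
      apply (derivable_pt_lim_minus (fun t => x * fst (zpow k (x, t)))
               (fun t => t * snd (zpow k (x, t)))).
      * now apply (derivable_pt_lim_scal (fun t => fst (zpow k (x, t)))).
      * now apply (M (fun t => snd (zpow k (x, t)))).
    + replace ((INR k + 1) * fst (zpow k (x, y))) with
        (x * (INR k * fst (zpow (pred k) (x, y))) +
         (1 * fst (zpow k (x, y)) + y * (- INR k * snd (zpow (pred k) (x, y))))) by lra.
      apply (derivable_pt_lim_plus (fun t => x * snd (zpow k (x, t)))
               (fun t => t * fst (zpow k (x, t)))).
      * now apply (derivable_pt_lim_scal (fun t => snd (zpow k (x, t)))).
      * now apply (M (fun t => fst (zpow k (x, t)))).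
Qed.

Lemma zpow_contC k p : contC (fun l => fst (zpow k l)) p /\ contC (fun l => snd (zpow k l)) p.
Proof.
  induction k as [|k [H1 H2]]; cbn [zpow Cmul fst snd]; split; contC_auto; auto.
Qed.

Lemma harmonic_poly_contC f p : harmonic_poly f -> contC f p.
Proof. induction 1; try apply zpow_contC; contC_auto; auto. Qed.

Lemma harmonic_poly_harm2 f p : harmonic_poly f ->
  exists al be, harm2 (fun x y => f (fst p + x, snd p + y)) al be.
Proof.
  intros Hf; revert p; induction Hf as [k|k|f g _ IHf _ IHg|c f _ IH]; intros p.
  - assert (Hh : harmonic_on (fun _ => True) (fun l => fst (zpow k l))).
    { exists (fun l => INR k * fst (zpow (pred k) l)), (fun l => - INR k * snd (zpow (pred k) l)),
        (fun l => INR k * (INR (pred k) * fst (zpow (pred (pred k)) l))),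
        (fun l => INR k * (- INR (pred k) * snd (zpow (pred (pred k)) l))),
        (fun l => - INR k * (INR (pred k) * snd (zpow (pred (pred k)) l))),
        (fun l => - INR k * (INR (pred k) * fst (zpow (pred (pred k)) l))).
      split; [|repeat split; apply contC_on; intros; contC_auto; apply zpow_contC].
      intros [x y] _; cbn [fst snd].
      destruct (zpow_deriv k x y) as [H1 [_ [H3 _]]].
      destruct (zpow_deriv (pred k) x y) as [D1 [D2 [D3 D4]]].
      repeat split; auto; try (apply derivable_pt_lim_scal; auto); ring. }
    destruct (harmonic_harm2 _ _ p 1 Rlt_0_1 (fun _ _ => I) Hh) as [a [b [H _]]]; eauto.
  - assert (Hh : harmonic_on (fun _ => True) (fun l => snd (zpow k l))).
    { exists (fun l => INR k * snd (zpow (pred k) l)), (fun l => INR k * fst (zpow (pred k) l)),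
        (fun l => INR k * (INR (pred k) * snd (zpow (pred (pred k)) l))),
        (fun l => INR k * (INR (pred k) * fst (zpow (pred (pred k)) l))),
        (fun l => INR k * (INR (pred k) * fst (zpow (pred (pred k)) l))),
        (fun l => INR k * (- INR (pred k) * snd (zpow (pred (pred k)) l))).
      split; [|repeat split; apply contC_on; intros; contC_auto; apply zpow_contC].
      intros [x y] _; cbn [fst snd].
      destruct (zpow_deriv k x y) as [_ [H2 [_ H4]]].
      destruct (zpow_deriv (pred k) x y) as [D1 [D2 [D3 D4]]].
      repeat split; auto; try (apply derivable_pt_lim_scal; auto); ring. }
    destruct (harmonic_harm2 _ _ p 1 Rlt_0_1 (fun _ _ => I) Hh) as [a [b [H _]]]; eauto.
  - destruct (IHf p) as [a [b Ha]], (IHg p) as [a' [b' Hb]].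
    exists (a + a'), (b + b'); now apply (harm2_plus (fun x y => f (fst p + x, snd p + y))
      (fun x y => g (fst p + x, snd p + y))).
  - destruct (IH p) as [a [b Ha]]; exists (c * a), (c * b).
    now apply (harm2_scal c (fun x y => f (fst p + x, snd p + y))).
Qed.

(** By the touching criterion a harmonic polynomial is subharmonic, and the constant [M] is a
    harmonic majorant on the unit disc. *)
Lemma harmonic_poly_max f M : harmonic_poly f ->
  (forall l, Cmod l = 1 -> f l <= M) -> forall l, Cmod l <= 1 -> f l <= M.
Proof.
  intros Hf HM l Hl.
  destruct (Rle_lt_or_eq_dec _ _ Hl) as [Hlt|Heq]; [|auto].
  assert (Hs : subharmonic_on (fun _ => True) (fun l => EFin (f l))).
  { apply no_touch_subharmonic.
    - discriminate.
    - intros p _; apply limsup_le_iff; intros k Hk; simpl in Hk.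
      destruct (harmonic_poly_contC f p Hf (k - f p)) as [d [Hd H]]; [lra|].
      exists d; split; auto; intros q _ Hq; specialize (H q Hq); apply Rabs_def2 in H; simpl; lra.
    - apply harm2_no_touch; intros; now apply harmonic_poly_harm2. }
  destruct Hs as [_ [_ Hs]].
  assert (H := Hs (0, 0) 1 (fun _ => M) Rlt_0_1 (fun _ _ => I)).
  simpl ER_le in H; apply H.
  - apply contC_on; intros; apply contC_const.
  - replace (fun _ : C => M) with (fun l : C => M + quad 0 0 0 0 (fst l - 0) (snd l - 0)).
    + apply (quad_harmonic _ (0, 0)).
    + extensionality q; unfold quad; ring.
  - intros q Hq; apply HM; now rewrite Cdist_0 in Hq.
  - now rewrite Cdist_0.
Qed.

(* On the unit circle the conjugate of [z] is its inverse, so that multiplication by [x] or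
   [y] maps [z^k] to a combination of [z^(k+1)] and [z^(k-1)]. *)
Lemma harmonic_poly_mul_coord f : harmonic_poly f ->
  exists fx fy, harmonic_poly fx /\ harmonic_poly fy /\
    forall l, Cmod l = 1 -> fx l = fst l * f l /\ fy l = snd l * f l.
Proof.
  assert (E : forall l, Cmod l = 1 -> fst l ^ 2 + snd l ^ 2 = 1).
  { intros l Hl; apply Cmod_eq in Hl; lra. }
  induction 1 as [k|k|f g _ [fx [fy [Fx [Fy F]]]] _ [gx [gy [Gx [Gy G]]]]|c f _ [fx [fy [Fx [Fy F]]]]].
  - destruct k as [|k].
    + exists (fun l => fst (zpow 1 l)), (fun l => snd (zpow 1 l)).
      repeat split; try constructor; simpl; ring.
    + exists (fun l => / 2 * (fst (zpow (S (S k)) l) + fst (zpow k l))),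
        (fun l => / 2 * (snd (zpow (S (S k)) l) + - 1 * snd (zpow k l))).
      split; [apply hp_scal, hp_plus; apply hp_re|].
      split; [apply hp_scal, hp_plus; [apply hp_im|apply hp_scal, hp_im]|].
      intros l Hl; specialize (E l Hl); cbn [zpow Cmul fst snd].
      set (a := fst (zpow k l)); set (b := snd (zpow k l)).
      split.
      * rewrite <- (Rmult_1_l a) at 3; rewrite <- E; field.
      * rewrite <- (Rmult_1_l b) at 3; rewrite <- E; field.
  - destruct k as [|k].
    + exists (fun _ => 0), (fun _ => 0); repeat split; try apply hp_const; simpl; ring.
    + exists (fun l => / 2 * (snd (zpow (S (S k)) l) + snd (zpow k l))),
        (fun l => / 2 * (fst (zpow k l) + - 1 * fst (zpow (S (S k)) l))).
      split; [apply hp_scal, hp_plus; apply hp_im|].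
      split; [apply hp_scal, hp_plus; [apply hp_re|apply hp_scal, hp_re]|].
      intros l Hl; specialize (E l Hl); cbn [zpow Cmul fst snd].
      set (a := fst (zpow k l)); set (b := snd (zpow k l)).
      split.
      * rewrite <- (Rmult_1_l b) at 3; rewrite <- E; field.
      * rewrite <- (Rmult_1_l a) at 1; rewrite <- E; field.
  - exists (fun l => fx l + gx l), (fun l => fy l + gy l).
    split; [now apply hp_plus|split; [now apply hp_plus|]].
    intros l Hl; destruct (F l Hl) as [-> ->], (G l Hl) as [-> ->]; split; ring.
  - exists (fun l => c * fx l), (fun l => c * fy l).
    split; [now apply hp_scal|split; [now apply hp_scal|]].
    intros l Hl; destruct (F l Hl) as [-> ->]; split; ring.
Qed.

(* The expected value of [f] at the end of a [k]-step walk from [s]: a step is [(e, 0)],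
   [(-e, 0)], [(0, e)] or [(0, -e)] with probability [(1 + x)/4], [(1 - x)/4], [(1 + y)/4],
   [(1 - y)/4]. This is a Bernstein-type polynomial in [l = (x, y)]. *)
Fixpoint walk (e : R) (k : nat) (f : C -> R) (s : C) (l : C) : R :=
  match k with
  | O => f s
  | S j => / 4 * (walk e j f (fst s + e, snd s) l + walk e j f (fst s - e, snd s) l +
                  walk e j f (fst s, snd s + e) l + walk e j f (fst s, snd s - e) l)
         + / 4 * (fst l * (walk e j f (fst s + e, snd s) l - walk e j f (fst s - e, snd s) l) +
                  snd l * (walk e j f (fst s, snd s + e) l - walk e j f (fst s, snd s - e) l))
  end.

(** On the unit circle both coordinates lie in [[-1, 1]], so the four transition probabilities are
    nonnegative and averaging preserves order. *)
Lemma walk_mono e k f g l : Cmod l = 1 -> (forall s, f s <= g s) ->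
  forall s, walk e k f s l <= walk e k g s l.
Proof.
  intros Hl Hfg. apply Cmod_eq in Hl; [|lra].
  assert (Hx : -1 <= fst l <= 1) by nra. assert (Hy : -1 <= snd l <= 1) by nra.
  induction k as [|k IH]; intros s; simpl; auto.
  pose proof (IH (fst s + e, snd s)); pose proof (IH (fst s - e, snd s)).
  pose proof (IH (fst s, snd s + e)); pose proof (IH (fst s, snd s - e)). nra.
Qed.

(** Mean and variance of a sum of [k] independent steps: one step has mean [(e x / 2, e y / 2)] and
    squared length [e ^ 2], so its variance is [e ^ 2] minus the squared mean. *)
Lemma walk_quadratic e k a K c l s :
  walk e k (fun s => a + K * ((fst s - fst c) ^ 2 + (snd s - snd c) ^ 2)) s l =
  a + K * ((fst s + INR k * (e * fst l / 2) - fst c) ^ 2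
         + (snd s + INR k * (e * snd l / 2) - snd c) ^ 2
         + INR k * (e ^ 2 - (e * fst l / 2) ^ 2 - (e * snd l / 2) ^ 2)).
Proof.
  revert s; induction k as [|k IH]; intros s.
  - simpl; ring.
  - cbn [walk]; rewrite !IH, S_INR; cbn [fst snd]; field.
Qed.

(** The recursion multiplies by the coordinates of [l], and on the circle such products are again
    values of harmonic polynomials. Inside the disc [H] and [walk] differ in general. *)
Lemma walk_harmonic e k f : forall s, exists H, harmonic_poly H /\
  forall l, Cmod l = 1 -> H l = walk e k f s l.
Proof.
  induction k as [|k IH]; intros s.
  - exists (fun _ => f s); split; [apply hp_const|auto].
  - destruct (IH (fst s + e, snd s)) as [h1 [P1 E1]], (IH (fst s - e, snd s)) as [h2 [P2 E2]],
      (IH (fst s, snd s + e)) as [h3 [P3 E3]], (IH (fst s, snd s - e)) as [h4 [P4 E4]].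
    assert (P12 : harmonic_poly (fun l => h1 l + - 1 * h2 l)) by (apply hp_plus; auto; now apply hp_scal).
    assert (P34 : harmonic_poly (fun l => h3 l + - 1 * h4 l)) by (apply hp_plus; auto; now apply hp_scal).
    destruct (harmonic_poly_mul_coord _ P12) as [fx [fy [Fx [_ F]]]].
    destruct (harmonic_poly_mul_coord _ P34) as [gx [gy [_ [Gy G]]]].
    exists (fun l => / 4 * (h1 l + h2 l + h3 l + h4 l) + / 4 * (fx l + gy l)); split.
    + apply hp_plus; apply hp_scal; repeat apply hp_plus; auto.
    + intros l Hl; simpl; rewrite <- E1, <- E2, <- E3, <- E4; auto.
      destruct (F l Hl) as [-> _], (G l Hl) as [_ ->]; ring.
Qed.

(* Chebyshev's inequality for the walk with [k] steps of length [2 / k], which has mean [l]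
   and variance at most [4 / k]. *)
Lemma walk_le k f a K l : (0 < k)%nat -> 0 <= K -> Cmod l = 1 ->
  (forall s, f s <= a + K * Cdist s l ^ 2) ->
  walk (2 / INR k) k f (0, 0) l <= a + K * (4 / INR k).
Proof.
  intros Hk HK Hl Hf. apply lt_0_INR in Hk.
  eapply Rle_trans.
  - apply (walk_mono _ _ f (fun s => a + K * ((fst s - fst l) ^ 2 + (snd s - snd l) ^ 2)) l Hl).
    intros s; eapply Rle_trans; [apply Hf|]; unfold Cdist; rewrite Cmod_sqr; simpl fst; simpl snd; lra.
  - rewrite walk_quadratic; cbn [fst snd].
    replace (0 + INR k * (2 / INR k * fst l / 2) - fst l) with 0 by (field; lra).
    replace (0 + INR k * (2 / INR k * snd l / 2) - snd l) with 0 by (field; lra).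
    apply Rplus_le_compat_l, Rmult_le_compat_l; auto.
    replace (4 / INR k) with (INR k * (2 / INR k) ^ 2) by (field; lra).
    rewrite <- (Rplus_0_l (INR k * (2 / INR k) ^ 2)).
    apply Rplus_le_compat; [lra|]. apply Rmult_le_compat_l; [lra|].
    pose proof (pow2_ge_0 (2 / INR k * fst l / 2)); pose proof (pow2_ge_0 (2 / INR k * snd l / 2)).
    lra.
Qed.

Lemma walk_opp e k f l s : walk e k (fun s => - f s) s l = - walk e k f s l.
Proof. revert s; induction k as [|k IH]; intros s; simpl; [|rewrite !IH]; ring. Qed.

Lemma walk_ge k f a K l : (0 < k)%nat -> 0 <= K -> Cmod l = 1 ->
  (forall s, a - K * Cdist s l ^ 2 <= f s) ->
  a - K * (4 / INR k) <= walk (2 / INR k) k f (0, 0) l.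
Proof.
  intros Hk HK Hl Hf.
  assert (H := walk_le k (fun s => - f s) (- a) K l Hk HK Hl).
  rewrite walk_opp in H. cut (- walk (2 / INR k) k f (0, 0) l <= - a + K * (4 / INR k)); [lra|].
  apply H; intros s; specialize (Hf s); lra.
Qed.

(** * Circular bounds and the minimum principle *)

Lemma near_prod_mono {X Y : Type} (nX : X -> R -> X -> Prop) (nY : Y -> R -> Y -> Prop) :
  (forall x r r' y, r <= r' -> nX x r y -> nX x r' y) ->
  (forall x r r' y, r <= r' -> nY x r y -> nY x r' y) ->
  forall p r r' q, r <= r' -> near_prod nX nY p r q -> near_prod nX nY p r' q.
Proof. intros mX mY p r r' q Hr [H1 H2]; split; eauto. Qed.

Lemma cont_in_plus {X : Type} (near : X -> R -> X -> Prop) K (f g : X -> R) :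
  (forall x r r' y, r <= r' -> near x r y -> near x r' y) ->
  cont_in near K f -> cont_in near K g -> cont_in near K (fun x => f x + g x).
Proof.
  intros mn cf cg x eps Kx He.
  destruct (cf x (eps / 2) Kx) as [r [Hr H]]; [lra|].
  destruct (cg x (eps / 2) Kx) as [r' [Hr' H']]; [lra|].
  exists (Rmin r r'); split; [now apply Rmin_glb_lt|]; intros y Ky Ny.
  specialize (H y Ky (mn _ _ _ _ (Rmin_l _ _) Ny)); specialize (H' y Ky (mn _ _ _ _ (Rmin_r _ _) Ny)).
  apply Rabs_def2 in H; apply Rabs_def2 in H'; apply Rabs_def1; lra.
Qed.

Lemma cont_in_mult {X : Type} (near : X -> R -> X -> Prop) K (f g : X -> R) :
  (forall x r r' y, r <= r' -> near x r y -> near x r' y) ->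
  cont_in near K f -> cont_in near K g -> cont_in near K (fun x => f x * g x).
Proof.
  intros mn cf cg x eps Kx He.
  pose proof (Rabs_pos (f x)); pose proof (Rabs_pos (g x)).
  set (c := 1 + Rabs (f x) + Rabs (g x)).
  assert (Hc : 1 <= c) by (unfold c; lra).
  set (eta := Rmin 1 (eps / (2 * c))).
  assert (Heta : 0 < eta) by (apply Rmin_glb_lt; [lra|apply Rdiv_lt_0_compat; lra]).
  assert (Heta1 : eta <= 1) by apply Rmin_l.
  assert (Heta2 : eta * c <= eps / 2).
  { apply Rle_trans with (eps / (2 * c) * c); [apply Rmult_le_compat_r; [lra|apply Rmin_r]|].
    right; field; lra. }
  destruct (cf x eta Kx Heta) as [r [Hr Hf]], (cg x eta Kx Heta) as [r' [Hr' Hg]].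
  exists (Rmin r r'); split; [now apply Rmin_glb_lt|]; intros y Ky Ny.
  specialize (Hf y Ky (mn _ _ _ _ (Rmin_l _ _) Ny)); specialize (Hg y Ky (mn _ _ _ _ (Rmin_r _ _) Ny)).
  replace (f y * g y - f x * g x)
    with ((f y - f x) * (g y - g x) + f x * (g y - g x) + g x * (f y - f x)) by ring.
  eapply Rle_lt_trans; [apply Rabs_triang|].
  eapply Rle_lt_trans; [apply Rplus_le_compat_r, Rabs_triang|].
  rewrite !Rabs_mult.
  pose proof (Rabs_pos (f y - f x)); pose proof (Rabs_pos (g y - g x)).
  apply Rle_lt_trans with (eta * c); [|lra]. unfold c.
  assert (Rabs (f y - f x) * Rabs (g y - g x) <= eta * 1) by (apply Rmult_le_compat; lra).
  assert (Rabs (f x) * Rabs (g y - g x) <= Rabs (f x) * eta) by (apply Rmult_le_compat_l; lra).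
  assert (Rabs (g x) * Rabs (f y - f x) <= Rabs (g x) * eta) by (apply Rmult_le_compat_l; lra).
  lra.
Qed.

Lemma cont_in_fst {X Y : Type} (nX : X -> R -> X -> Prop) (nY : Y -> R -> Y -> Prop)
  (K : X -> Prop) (L : X * Y -> Prop) f : (forall p, L p -> K (fst p)) ->
  cont_in nX K f -> cont_in (near_prod nX nY) L (fun p => f (fst p)).
Proof.
  intros LK cf p eps Lp He; destruct (cf (fst p) eps (LK p Lp) He) as [r [Hr H]].
  exists r; split; auto; intros q Lq [N1 _]; auto.
Qed.

Lemma cont_in_snd {X Y : Type} (nX : X -> R -> X -> Prop) (nY : Y -> R -> Y -> Prop)
  (K : Y -> Prop) (L : X * Y -> Prop) f : (forall p, L p -> K (snd p)) ->
  cont_in nY K f -> cont_in (near_prod nX nY) L (fun p => f (snd p)).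
Proof.
  intros LK cf p eps Lp He; destruct (cf (snd p) eps (LK p Lp) He) as [r [Hr H]].
  exists r; split; auto; intros q Lq [_ N2]; auto.
Qed.

Lemma logmod_between (l : C) (a b : R) :
  exp a <= Cmod l <= exp b <-> 0 < Cmod l /\ a <= logmod l <= b.
Proof.
  pose proof (exp_pos a); split.
  - intros [H1 H2]; assert (H0 : 0 < Cmod l) by lra; split; auto.
    rewrite <- (exp_logmod l H0) in H1, H2.
    split; apply Rnot_lt_le; intros H3; apply exp_increasing in H3; lra.
  - intros [H0 [H1 H2]]; rewrite <- (exp_logmod l H0).
    split; [destruct H1 as [H1|<-]|destruct H2 as [H2|<-]]; try lra;
    apply Rlt_le, exp_increasing; auto.
Qed.

Lemma annS_logmod (l : C) : annS l <-> 0 < Cmod l /\ 0 < logmod l < 1.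
Proof.
  unfold annS; split.
  - intros [H1 H2]; assert (H0 : 0 < Cmod l) by lra; split; auto.
    rewrite <- exp_0 in H1; rewrite <- (exp_logmod l H0) in H1, H2; split; now apply exp_lt_inv.
  - intros [H0 [H1 H2]]; rewrite <- (exp_logmod l H0).
    apply exp_increasing in H1, H2; rewrite exp_0 in H1; lra.
Qed.

Lemma annS_exp (l : C) t : Cmod l = exp t -> 0 < t < 1 -> annS l.
Proof.
  intros H Ht; apply annS_logmod; rewrite (logmod_exp l t H), H; split; auto; apply exp_pos.
Qed.

(** [l'] is rescaled by [exp (t - t')]; the bound [t' <= 1] keeps its modulus at most [exp 1], so
    [rho] depends on [del] only. *)
Lemma radial_neighbour (del : R) : 0 < del -> exists rho, 0 < rho /\
  forall t t' l', Rabs (t' - t) < rho -> t' <= 1 -> Cmod l' = exp t' ->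
    exists l, Cmod l = exp t /\ Cdist l' l < del.
Proof.
  intros Hd. pose proof (exp_pos 1) as He.
  assert (Hc : continuity_pt exp 0) by (apply derivable_continuous_pt, derivable_pt_exp).
  destruct (Hc (del / exp 1)) as [rho [Hrho H]]; [now apply Rdiv_lt_0_compat|].
  exists rho; split; auto; intros t t' l' Ht Ht1 Hl.
  exists (Cmul (exp (t - t'), 0) l'); split.
  - rewrite Cmod_mul, Hl.
    replace (Cmod (exp (t - t'), 0)) with (exp (t - t')).
    + rewrite <- exp_plus; f_equal; ring.
    + symmetry; apply Cmod_eq; [left; apply exp_pos|simpl; ring].
  - replace (Cdist l' (Cmul (exp (t - t'), 0) l')) with (Cmod (Cmul (1 - exp (t - t'), 0) l')).
    2:{ unfold Cdist; f_equal; unfold Cmul; simpl; f_equal; ring. }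
    rewrite Cmod_mul, Hl.
    assert (Hm : Rabs (exp (t - t') - exp 0) < del / exp 1).
    { destruct (Req_dec (t - t') 0) as [->|Hn].
      - rewrite Rminus_diag_eq, Rabs_R0 by auto; now apply Rdiv_lt_0_compat.
      - apply (H (t - t')); split; [split; [exact I|auto]|].
        change (Rabs (t - t' - 0) < rho); rewrite Rminus_0_r, Rabs_minus_sym; auto. }
    replace (Cmod (1 - exp (t - t'), 0)) with (Rabs (exp (t - t') - exp 0)).
    2:{ symmetry; apply Cmod_eq; [apply Rabs_pos|]; rewrite pow2_abs, exp_0; simpl; ring. }
    apply Rle_lt_trans with (Rabs (exp (t - t') - exp 0) * exp 1).
    + apply Rmult_le_compat_l; [apply Rabs_pos|].
      destruct Ht1 as [Ht1|<-]; [left; now apply exp_increasing|lra].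
    + apply Rmult_lt_reg_r with (/ exp 1); [now apply Rinv_0_lt_compat|].
      rewrite Rmult_assoc, Rinv_r, Rmult_1_r; [exact Hm|lra].
Qed.

Lemma ballN_pt {n} l (z : Cn n) r l' z' :
  ballN (pt l z) r (pt l' z') <-> Cdist l' l < r /\ ballN z r z'.
Proof.
  split.
  - intros H; split; [exact (H Fin.F1)|intros i; exact (H (Fin.FS i))].
  - intros [H1 H2] i; apply (Fin.caseS' i); [exact H1|exact H2].
Qed.

Lemma line_pt {n} l (z : Cn n) u v B x y :
  line (pt l z) (pt (u, v) B) x y =
  pt (fst l + (x * u - y * v), snd l + (x * v + y * u)) (line z B x y).
Proof. extensionality i; apply (Fin.caseS' i); [reflexivity|intros; reflexivity]. Qed.

Section Annulus.
Context {n : nat} (D : Cn n -> Prop) (Phi : Cn (S n) -> ER).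
Implicit Types (z A B : Cn n).
Context (HPhi : PSHneg (DxS D) Phi).

(** The circular maximum enters only through its real upper bounds, which keeps [-oo] out of the
    arithmetic. *)
Definition circle_le z (t m : R) : Prop :=
  forall l, Cmod l = exp t -> ER_le (Phi (pt l z)) (EFin m).

Lemma circle_le_mono z t m m' : m <= m' -> circle_le z t m -> circle_le z t m'.
Proof. intros Hm H l Hl; apply ER_le_trans with (1 := H l Hl); simpl; lra. Qed.

Lemma Phi_usc z l k : D z -> annS l -> ~ ER_le (EFin k) (Phi (pt l z)) ->
  exists r, 0 < r /\ forall z' l', D z' -> annS l' -> ballN z r z' -> Cdist l' l < r ->
    ER_le (Phi (pt l' z')) (EFin k).
Proof.
  intros Dz Al Hk. destruct HPhi as [[_ [uu _]] _].
  destruct (proj1 (usc_on_iff _ _) uu (pt l z) k (conj Dz Al) Hk) as [r [Hr H]].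
  exists r; split; auto; intros z' l' Dz' Al' Nz Nl; apply H; [split; auto|now apply ballN_pt].
Qed.

Lemma circle_le_neg z t : D z -> 0 < t < 1 -> circle_le z t 0.
Proof. intros Dz Ht l Hl; apply HPhi; split; [exact Dz|now apply annS_exp with t]. Qed.

Lemma Phi_not_PInf z l : D z -> annS l -> Phi (pt l z) <> PInf.
Proof. intros Dz Al; apply HPhi; split; auto. Qed.

(** Compactness of the circle turns the pointwise upper semicontinuity of [Phi] into one [del];
    radial rescaling then reaches the nearby circles. *)
Lemma circle_le_open z t m m' : D z -> 0 < t < 1 -> circle_le z t m -> m < m' ->
  exists r, 0 < r /\ forall x t', D x -> ballN z r x -> Rabs (t' - t) < r -> 0 < t' < 1 ->
    circle_le x t' m'.
Proof.
  intros Dz Ht Hm Hmm.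
  destruct (compact_Cmod (exp t) (exp t) (fun W => exists del, 0 < del /\
     forall l l' x, W l -> annS l' -> D x -> ballN z del x -> Cdist l' l < del ->
       ER_le (Phi (pt l' x)) (EFin m'))) as [del [Hdel H]].
  - exists 1; split; [lra|tauto].
  - intros V W VW [d [Hd H]]; exists d; split; auto; intros; eapply H; eauto.
  - intros V W [d [Hd HV]] [d' [Hd' HW]]; exists (Rmin d d'); split; [now apply Rmin_glb_lt|].
    pose proof (Rmin_l d d'); pose proof (Rmin_r d d').
    intros l l' x [Vl|Wl] Al Dx Nx Nl.
    + apply (HV l); auto; [intros i; specialize (Nx i)|]; lra.
    + apply (HW l); auto; [intros i; specialize (Nx i)|]; lra.
  - intros l Hl. assert (El : Cmod l = exp t) by lra.
    destruct (Phi_usc z l m') as [r [Hr H]]; auto; [now apply annS_exp with t| |].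
    { intros Hc; assert (Hc' := ER_le_trans _ _ _ Hc (Hm l El)); simpl in Hc'; lra. }
    exists (r / 2); split; [lra|]. exists (r / 2); split; [lra|].
    intros l1 l' x [_ N1] Al Dx Nx Nl. apply H; auto.
    + intros i; specialize (Nx i); lra.
    + unfold nearC in N1; pose proof (Cdist_triangle l' l1 l); lra.
  - destruct (radial_neighbour del Hdel) as [rho [Hrho Hr]].
    exists (Rmin del rho); split; [now apply Rmin_glb_lt|]; intros x t' Dx Nx Nt Ht' l' Hl'.
    pose proof (Rmin_l del rho); pose proof (Rmin_r del rho).
    destruct (Hr t t' l') as [l [El Nl]]; auto; try lra.
    apply (H l); auto; [lra|now apply annS_exp with t'|].
    intros i; specialize (Nx i); lra.
Qed.

(** Since [a + b log |zeta|] is harmonic, an excess of [Phi] over it inside would give an interior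
    maximum of the difference plus [e |zeta|^2], hence a touching polynomial in the fibre over
    [z]. *)
Lemma three_circles z t1 t t2 a b : D z -> 0 < t1 -> t1 < t < t2 -> t2 < 1 ->
  circle_le z t1 (a + b * t1) -> circle_le z t2 (a + b * t2) -> circle_le z t (a + b * t).
Proof.
  intros Dz Ht1 Ht Ht2 H1 H2 l1 Hl1. apply NNPP; intro Hn.
  assert (A1 : annS l1) by (apply annS_exp with t; auto; lra).
  destruct (Phi (pt l1 z)) as [|phi1|] eqn:E1; [apply Hn; simpl; auto| |now apply (Phi_not_PInf z l1)].
  simpl in Hn; apply Rnot_le_lt in Hn.
  set (gap := phi1 - (a + b * t)). assert (Hgap : 0 < gap) by (unfold gap; lra).
  pose proof (exp_pos 1) as He1. assert (He2 : 0 < exp 1 ^ 2) by now apply pow_lt.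
  (* The perturbation [e |zeta|^2] is then at most [gap / 2] on the annulus. *)
  set (e := gap / (2 * exp 1 ^ 2)).
  assert (He : 0 < e) by (apply Rdiv_lt_0_compat; lra).
  assert (Ege : e * exp 1 ^ 2 = gap / 2) by (unfold e; field; lra).
  set (K := fun l => exp t1 <= Cmod l <= exp t2).
  assert (KS : forall l, K l -> 0 < Cmod l /\ t1 <= logmod l <= t2 /\ annS l).
  { intros l Kl; apply logmod_between in Kl as [Hl Kl]; repeat split; try lra;
    apply annS_logmod; lra. }
  set (g := fun l => - (a + b * logmod l) + e * Cmod l ^ 2).
  destruct (usc_attains_max nearC K (fun l => ER_addR (Phi (pt l z)) (g l))) as [l0 [K0 Hmax]].
  - apply compact_Cmod.
  - apply usc_in_addR; [apply nearC_mono| |].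
    + intros l k Kl Hk. destruct (Phi_usc z l k) as [r [Hr H]]; auto; [now apply KS|].
      exists r; split; auto; intros y Ky Ny; apply H; auto; [now apply KS|].
      intros i; rewrite Cdist_refl; lra.
    + apply contC_in; intros p Kp; unfold g; apply contC_plus; [|contC_auto].
      apply contC_opp, contC_plus; [contC_auto|].
      apply (contC_mult (fun _ => b)); [contC_auto|apply logmod_contC; now apply KS].
  - intros l Kl Hi; apply (Phi_not_PInf z l Dz); [now apply KS|].
    destruct (Phi (pt l z)); auto; discriminate.
  - exists l1; apply logmod_between; rewrite (logmod_exp l1 t Hl1), Hl1.
    split; [apply exp_pos|lra].
  - assert (K1 : K l1).
    { apply logmod_between; rewrite (logmod_exp l1 t Hl1), Hl1; split; [apply exp_pos|lra]. }
    assert (H0 := Hmax l1 K1); rewrite E1 in H0.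
    destruct (KS l0 K0) as [P0 [L0 A0]].
    destruct (Phi (pt l0 z)) as [|phi0|] eqn:E0; simpl in H0; try contradiction;
      [|now apply (Phi_not_PInf z l0)].
    assert (H0' : gap < phi0 + g l0).
    { apply Rlt_le_trans with (2 := H0); unfold g, gap; rewrite (logmod_exp l1 t Hl1), Hl1.
      assert (0 < e * exp t ^ 2); [|lra]. apply Rmult_lt_0_compat, pow_lt, exp_pos; auto. }
    assert (Hb : e * Cmod l0 ^ 2 < gap).
    { assert (Cmod l0 ^ 2 <= exp 1 ^ 2).
      { apply pow_incr; unfold annS in A0; lra. }
      assert (e * Cmod l0 ^ 2 <= e * exp 1 ^ 2) by (apply Rmult_le_compat_l; lra). lra. }
    assert (Hin : t1 < logmod l0 < t2).
    { assert (Hb1 : logmod l0 <> t1).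
      { intros El; assert (Ec : Cmod l0 = exp t1) by (rewrite <- El; now rewrite exp_logmod).
        specialize (H1 l0 Ec); rewrite E0 in H1; simpl in H1; unfold g in H0'; rewrite El in H0'; lra. }
      assert (Hb2 : logmod l0 <> t2).
      { intros El; assert (Ec : Cmod l0 = exp t2) by (rewrite <- El; now rewrite exp_logmod).
        specialize (H2 l0 Ec); rewrite E0 in H2; simpl in H2; unfold g in H0'; rewrite El in H0'; lra. }
      lra. }
    destruct (logmod_harm2 l0 1 0 P0) as [u [v [Euv Hh]]].
    assert (Huv : 0 < u ^ 2 + v ^ 2).
    { rewrite Euv; apply Rmult_lt_0_compat; [lra|now apply pow_lt]. }
    destruct (logmod_contC l0 P0 (Rmin (logmod l0 - t1) (t2 - logmod l0))) as [d [Hd Hc]].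
    { apply Rmin_glb_lt; lra. }
    set (del := Rmin d (Cmod l0)). assert (Hdel : 0 < del) by now apply Rmin_glb_lt.
    set (w := Cmod (u, v)).
    assert (Hw : 0 < w).
    { assert (0 <= w) by apply Cmod_ge0.
      destruct (Req_dec w 0) as [Hw0|]; [|lra].
      assert (w ^ 2 = u ^ 2 + v ^ 2) by apply Cmod_sqr. rewrite Hw0 in *; lra. }
    (* The line stays in the fibre over [z]. Along it [e |zeta|^2] has the trace part
       [e (u^2 + v^2)(x^2 + y^2)], which supplies [kap], and a linear part that goes into [quad]. *)
    apply (psh_touch_harm2 (DxS D) Phi (pt l0 z) (pt (u, v) (fun _ => (0, 0))) phi0
             (fun x y => b * logmod (fst l0 + (x * u - y * v), snd l0 + (x * v + y * u)) +
                (0 + quad (- 2 * e * (fst l0 * u + snd l0 * v)) (- 2 * e * (snd l0 * u - fst l0 * v))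
                       0 0 x y))
             _ _ (e * (u ^ 2 + v ^ 2)) (del / w) (proj1 HPhi) E0
             (harm2_plus _ _ _ _ _ _ (harm2_scal b _ _ _ Hh) (harm2_quad _ _ _ _ _))).
    + now apply Rmult_lt_0_compat.
    + now apply Rdiv_lt_0_compat.
    + intros x y Hxy.
      assert (Ez : line z (fun _ => (0, 0)) x y = z).
      { extensionality i; unfold line, Cn_add, Cn_scal, Cadd, Cmul; destruct (z i); simpl; f_equal; ring. }
      rewrite line_pt, Ez. set (l := (_, _)).
      assert (Nl : Cdist l l0 < del).
      { replace (Cdist l l0) with (Cmod (x, y) * w).
        - apply Rmult_lt_reg_r with (/ w); [now apply Rinv_0_lt_compat|].
          rewrite Rmult_assoc, Rinv_r, Rmult_1_r by lra.
          apply Cmod_lt; [apply Rlt_le, Rdiv_lt_0_compat; lra|exact Hxy].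
        - unfold w; rewrite <- Cmod_mul; unfold Cdist, l, Cmul; f_equal; cbn [fst snd]; f_equal; ring. }
      assert (Dd : del <= d) by apply Rmin_l; assert (Dc : del <= Cmod l0) by apply Rmin_r.
      assert (Pl : 0 < Cmod l).
      { pose proof (Cdist_triangle l0 l (0, 0)) as T; rewrite !Cdist_0, (Cdist_sym l0 l) in T; lra. }
      assert (Kl : K l).
      { apply logmod_between; split; auto. specialize (Hc l ltac:(lra)).
        pose proof (Rmin_l (logmod l0 - t1) (t2 - logmod l0)).
        pose proof (Rmin_r (logmod l0 - t1) (t2 - logmod l0)).
        apply Rabs_def2 in Hc; lra. }
      split; [split; [exact Dz|now apply KS]|].
      specialize (Hmax l Kl); cbv beta in Hmax.
      unfold g in Hmax; rewrite !Cmod_sqr in Hmax.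
      replace (fst l0 + (0 * u - 0 * v), snd l0 + (0 * v + 0 * u)) with l0
        by (destruct l0; simpl; f_equal; ring).
      destruct (Phi (pt l z)) as [|phi|]; simpl in Hmax |- *; auto.
      unfold l in Hmax; unfold quad; cbn [fst snd] in *; fold l in Hmax; lra.
Qed.

(* [inf_t (max_{|zeta| = e^t} Phi(z, zeta) - s t - d)]; the function [w_s] above is the case
   [d = - max(s, 0)]. *)
Definition fibre_inf (s d : R) z : ER :=
  ER_inf (fun a => exists k t, 0 < t < 1 /\ circle_le z t (k + s * t + d) /\ a = EFin k).

Lemma fibre_inf_le s d z k t : 0 < t < 1 -> circle_le z t (k + s * t + d) -> ER_le (fibre_inf s d z) (EFin k).
Proof. intros Ht H; apply ER_inf_spec; eauto. Qed.

Lemma fibre_inf_lt s d z k : ~ ER_le (EFin k) (fibre_inf s d z) ->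
  exists k' t, k' < k /\ 0 < t < 1 /\ circle_le z t (k' + s * t + d).
Proof.
  intros Hk; apply NNPP; intro Hn; apply Hk; apply ER_inf_spec.
  intros a [k' [t [Ht [H ->]]]]; simpl; apply Rnot_lt_le; intro; apply Hn; eauto.
Qed.

Lemma fibre_inf_not_PInf s d z : D z -> fibre_inf s d z <> PInf.
Proof.
  intros Dz E.
  assert (H : ER_le (fibre_inf s d z) (EFin (- s / 2 - d))).
  { apply fibre_inf_le with (1 / 2); [lra|].
    apply circle_le_mono with 0; [lra|]; apply circle_le_neg; auto; lra. }
  rewrite E in H; exact H.
Qed.

Lemma fibre_inf_usc s d : usc_on D (fibre_inf s d).
Proof.
  apply usc_on_iff; intros z k Dz Hk.
  destruct (fibre_inf_lt s d z k Hk) as [k' [t [Hk' [Ht H]]]].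
  destruct (circle_le_open z t _ (k + s * t + d) Dz Ht H) as [r [Hr Ho]]; [lra|].
  exists r; split; auto; intros x Dx Nx; apply fibre_inf_le with t; auto; apply Ho; auto.
  rewrite Rminus_diag_eq, Rabs_R0; auto.
Qed.

End Annulus.

Section Kiselev.
Context {n : nat} (D : Cn n -> Prop) (Phi : Cn (S n) -> ER).
Context (HPhi : PSHneg (DxS D) Phi).
Context (s d : R) (A B : Cn n) (h : C -> R) (eps : R).
Context (hc : forall p, contC h p) (Heps : 0 < eps).
Let Z (l : C) : Cn n := Cn_add A (Cn_scal l B).
Context (DZ : forall l, Cmod l <= 1 -> D (Z l)).
Context (Hkis : forall l, Cmod l = 1 -> ER_le (fibre_inf Phi s d (Z l)) (EFin (h l))).

(** The extra [eps] over the bound in [Hkis] makes the condition stable under small changes of [l]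
    and [t]. *)
Let good (l : C) (t : R) : Prop := circle_le Phi (Z l) t (h l + eps + s * t + d).

Lemma good_convex l t1 t t2 : Cmod l <= 1 -> 0 < t1 -> t1 < t < t2 -> t2 < 1 ->
  good l t1 -> good l t2 -> good l t.
Proof.
  intros Hl Ht1 Ht Ht2 G1 G2.
  assert (E : forall r, h l + eps + s * r + d = (h l + eps + d) + s * r) by (intros; ring).
  unfold good in *; rewrite E in *.
  now apply (three_circles D Phi HPhi (Z l) t1 t t2); auto.
Qed.

(** A Lebesgue number argument over the unit circle. A [t] is offered for every [q] in the plane,
    because the random walk also visits points off the circle; for [q] far from it the condition is
    vacuous. *)
Lemma good_uniform : exists del rho, 0 < del /\ 0 < rho <= 1 / 2 /\
  forall q, exists t, rho <= t <= 1 - rho /\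
    forall l t', Cmod l = 1 -> Cdist l q < del -> Rabs (t' - t) < rho -> 0 < t' < 1 -> good l t'.
Proof.
  destruct (compact_Cmod 1 1 (fun W => exists del rho, 0 < del /\ 0 < rho <= 1 / 2 /\
    forall q, W q -> exists t, rho <= t <= 1 - rho /\
      forall l t', Cmod l = 1 -> Cdist l q < del -> Rabs (t' - t) < rho -> 0 < t' < 1 ->
        good l t')) as [del [rho [Hdel [Hrho H]]]].
  - exists 1, (1 / 2); split; [lra|split; [lra|tauto]].
  - intros V W VW [del [rho [Hdel [Hrho H]]]]; exists del, rho; split; auto.
  - intros V W [d1 [r1 [Hd1 [Hr1 H1]]]] [d2 [r2 [Hd2 [Hr2 H2]]]].
    pose proof (Rmin_l d1 d2); pose proof (Rmin_r d1 d2).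
    pose proof (Rmin_l r1 r2); pose proof (Rmin_r r1 r2).
    exists (Rmin d1 d2), (Rmin r1 r2); split; [now apply Rmin_glb_lt|].
    split; [split; [apply Rmin_glb_lt; lra|lra]|].
    intros q [Vq|Wq].
    + destruct (H1 q Vq) as [t [Ht G]]; exists t; split; [lra|]; intros; apply G; auto; lra.
    + destruct (H2 q Wq) as [t [Ht G]]; exists t; split; [lra|]; intros; apply G; auto; lra.
  - intros q Hq. assert (Eq : Cmod q = 1) by lra.
    destruct (fibre_inf_lt Phi s d (Z q) (h q + eps / 4)) as [k [t [Hk [Ht G]]]].
    { intros Hn; assert (Hc := ER_le_trans _ _ _ Hn (Hkis q Eq)); simpl in Hc; lra. }
    destruct (circle_le_open D Phi HPhi (Z q) t _ (h q + eps / 4 + s * t + d)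
                (DZ q ltac:(lra)) Ht G) as [r [Hr Ho]]; [lra|].
    destruct (hc q (eps / 4)) as [d1 [Hd1 Hh]]; [lra|].
    destruct (ballN_line A B) as [M [HM HB]].
    pose proof (Rabs_pos s).
    set (del := Rmin d1 (r / M)).
    assert (Hdel : 0 < del) by (apply Rmin_glb_lt; auto; now apply Rdiv_lt_0_compat).
    assert (Ld1 : del <= d1) by apply Rmin_l. assert (LrM : del <= r / M) by apply Rmin_r.
    (* [r1] keeps the change of [s t] within [eps / 4]; with [eps / 4] of slack at [q] and [eps / 4]
       for the change of [h], the total stays below [eps]. *)
    set (r1 := eps / (4 * (Rabs s + 1))).
    assert (Hr1 : 0 < r1) by (apply Rdiv_lt_0_compat; lra).
    assert (Er1 : Rabs s * r1 <= eps / 4).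
    { apply Rle_trans with ((Rabs s + 1) * r1); [apply Rmult_le_compat_r; lra|].
      right; unfold r1; field; lra. }
    set (rho := Rmin (Rmin r r1) (Rmin t (1 - t) / 2)).
    assert (Hmt : 0 < Rmin t (1 - t)) by (apply Rmin_glb_lt; lra).
    pose proof (Rmin_l t (1 - t)); pose proof (Rmin_r t (1 - t)).
    pose proof (Rmin_l r r1); pose proof (Rmin_r r r1).
    assert (L1 : rho <= Rmin r r1) by apply Rmin_l.
    assert (L2 : rho <= Rmin t (1 - t) / 2) by apply Rmin_r.
    assert (Hrho : 0 < rho).
    { apply Rmin_glb_lt; [now apply Rmin_glb_lt|lra]. }
    exists (del / 2); split; [lra|]. exists (del / 2), rho; split; [lra|]; split; [lra|].
    intros q' [_ Nq]; exists t; split; [lra|]; intros l t' Hl Nl Nt Ht'.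
    unfold nearC in Nq. pose proof (Cdist_triangle l q' q).
    apply circle_le_mono with (h q + eps / 4 + s * t + d).
    + specialize (Hh l ltac:(lra)); apply Rabs_def2 in Hh.
      assert (Hst : Rabs (s * (t' - t)) <= eps / 4).
      { rewrite Rabs_mult; apply Rle_trans with (2 := Er1), Rmult_le_compat_l; lra. }
      apply Rabs_le_between in Hst; lra.
    + apply Ho; auto; [apply DZ; lra| |lra]. apply HB; auto; lra.
  - exists (del / 2), rho; split; [lra|split; [auto|]]; intros q.
    destruct (classic (exists q', 1 <= Cmod q' <= 1 /\ Cdist q' q < del / 2)) as [[q' [Kq Nq]]|Hn].
    + destruct (H q' Kq) as [t [Ht G]]; exists t; split; auto; intros l t' Hl Nl.
      apply G; auto; pose proof (Cdist_triangle l q q'); rewrite (Cdist_sym q q') in *; lra.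
    + exists (1 / 2); split; [lra|]; intros l t' Hl Nl; exfalso; apply Hn.
      exists l; split; [lra|auto].
Qed.

(** The pointwise choice [f] may jump; the walk averages it into [H]. Up to [rho / 4], the value
    [H l] lies between [f q1] and [f q2] for points [q1], [q2] within [del] of [l], and convexity
    fills in the radii between the two intervals of good ones. *)
Lemma good_harmonic_selection : exists rho H, 0 < rho /\ harmonic_poly H /\
  (forall l, Cmod l <= 1 -> rho <= H l <= 1 - rho) /\
  (forall l t, Cmod l = 1 -> Rabs (t - H l) <= rho / 4 -> good l t).
Proof.
  destruct good_uniform as [del [rho [Hdel [Hrho Hu]]]].
  set (P := fun q t => rho <= t <= 1 - rho /\
    forall l t', Cmod l = 1 -> Cdist l q < del -> Rabs (t' - t) < rho -> 0 < t' < 1 -> good l t').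
  set (f := fun q => epsilon (inhabits 0) (P q)).
  assert (Hf : forall q, P q (f q)) by (intros q; apply epsilon_spec, Hu).
  (* The parabola [K |q - l|^2] is at least [1] outside the disc of radius [del] about [l] and so
     outweighs the variation of [f], whose values lie in [[0, 1]]; the large [k] below makes the
     variance term smaller than [rho / 8]. *)
  set (K := / del ^ 2).
  assert (Hd2 : 0 < del ^ 2) by now apply pow_lt.
  assert (HK : 0 < K) by now apply Rinv_0_lt_compat.
  destruct (INR_unbounded (K * 32 / rho)) as [k Hk].
  assert (Hk0 : 0 < K * 32 / rho) by (apply Rdiv_lt_0_compat; lra).
  assert (Hkn : (0 < k)%nat) by (apply INR_lt; simpl; lra).
  assert (HKk : K * (4 / INR k) < rho / 8).
  { apply Rmult_lt_reg_r with (8 * INR k / rho); [apply Rdiv_lt_0_compat; lra|].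
    replace (K * (4 / INR k) * (8 * INR k / rho)) with (K * 32 / rho) by (field; lra).
    replace (rho / 8 * (8 * INR k / rho)) with (INR k) by (field; lra); auto. }
  destruct (walk_harmonic (2 / INR k) k f (0, 0)) as [H [HH EH]].
  assert (Hup : forall l, Cmod l = 1 -> H l <= 1 - rho).
  { intros l Hl; rewrite EH by auto.
    apply Rle_trans with (1 - rho + 0 * (4 / INR k)); [|lra].
    apply walk_le; auto; [lra|]; intros q; destruct (Hf q) as [[_ Hq] _]; lra. }
  assert (Hlo : forall l, Cmod l = 1 -> rho <= H l).
  { intros l Hl; rewrite EH by auto.
    apply Rle_trans with (rho - 0 * (4 / INR k)); [lra|].
    apply walk_ge; auto; [lra|]; intros q; destruct (Hf q) as [[Hq _] _]; lra. }
  assert (Hfar : forall l q, Cdist l q >= del -> 1 <= K * Cdist q l ^ 2).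
  { intros l q Hq; rewrite Cdist_sym in Hq. unfold K.
    apply Rmult_le_reg_l with (del ^ 2); auto.
    rewrite <- Rmult_assoc, Rinv_r, Rmult_1_l, Rmult_1_r by lra.
    apply pow_incr; lra. }
  exists rho, H; split; [lra|split; [auto|split]].
  - intros l Hl; split.
    + assert (H1 := harmonic_poly_max (fun l => - 1 * H l) (- rho) (hp_scal (- 1) H HH)).
      cbv beta in H1; cut (-1 * H l <= - rho); [lra|].
      apply H1; auto; intros q Hq; specialize (Hlo q Hq); lra.
    + now apply (harmonic_poly_max H).
  - intros l t Hl Ht. set (T := H l) in *.
    assert (HT : rho <= T <= 1 - rho) by (unfold T; auto).
    assert (N0 : forall q, 0 <= K * Cdist q l ^ 2).
    { intros; apply Rmult_le_pos; [lra|apply pow2_ge_0]. }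
    (* If [f] exceeded [T + rho / 4] throughout the [del]-disc, the lower Chebyshev bound would put
       the mean [H l] above [T]. *)
    assert (S1 : exists q, Cdist l q < del /\ f q <= T + rho / 4).
    { apply NNPP; intro Hn.
      assert (Hw : T + rho / 4 - K * (4 / INR k) <= H l); [|fold T in Hw; lra].
      rewrite EH by auto; apply walk_ge; auto; [lra|]; intros q.
      destruct (Rlt_or_le (Cdist l q) del) as [Hq|Hq].
      - specialize (N0 q). apply Rnot_lt_le; intro; apply Hn; exists q; split; auto; lra.
      - specialize (Hfar l q (Rle_ge _ _ Hq)); destruct (Hf q) as [[Hq1 _] _]; lra. }
    assert (S2 : exists q, Cdist l q < del /\ T - rho / 4 <= f q).
    { apply NNPP; intro Hn.
      assert (Hw : H l <= T - rho / 4 + K * (4 / INR k)); [|fold T in Hw; lra].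
      rewrite EH by auto; apply walk_le; auto; [lra|]; intros q.
      destruct (Rlt_or_le (Cdist l q) del) as [Hq|Hq].
      - specialize (N0 q). apply Rnot_lt_le; intro; apply Hn; exists q; split; auto; lra.
      - specialize (Hfar l q (Rle_ge _ _ Hq)); destruct (Hf q) as [[_ Hq1] _]; lra. }
    destruct S1 as [q1 [N1 F1]], S2 as [q2 [N2 F2]].
    destruct (Hf q1) as [R1 G1], (Hf q2) as [R2 G2].
    apply Rabs_le_between in Ht.
    destruct (Rlt_or_le (Rabs (t - f q1)) rho) as [C1|C1]; [apply G1; auto; lra|].
    destruct (Rlt_or_le (Rabs (t - f q2)) rho) as [C2|C2]; [apply G2; auto; lra|].
    assert (O1 : f q1 < t) by (unfold Rabs in C1; destruct Rcase_abs; lra).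
    assert (O2 : t < f q2) by (unfold Rabs in C2; destruct Rcase_abs; lra).
    apply (good_convex l (f q1) t (f q2)); try lra.
    + apply G1; auto; [rewrite Rminus_diag_eq, Rabs_R0; auto; lra|lra].
    + apply G2; auto; [rewrite Rminus_diag_eq, Rabs_R0; auto; lra|lra].
Qed.

(* Along the graph [log |zeta| = H], the maximum principle for [Phi - s log |zeta|] against the
   harmonic [h]: the graph is not a complex line, so [Phi - s log |zeta|] is maximised over the
   whole solid with the penalty [N (log |zeta| - H)^2], and at a maximum one moves along the
   complex line on which the penalty is stationary. *)
Lemma fibre_inf_center (hh : harmonic_on (fun _ => True) h) :
  ER_le (fibre_inf Phi s d (Z (0, 0))) (EFin (h (0, 0) + 3 * eps)).
Proof.
  destruct good_harmonic_selection as [rho [H [Hrho [HH [Hran Hsel]]]]].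
  assert (C00 : Cmod (0, 0) = 0) by (apply Cmod_eq; simpl; lra).
  assert (Hran0 := Hran (0, 0) ltac:(rewrite C00; lra)).
  apply fibre_inf_le with (H (0, 0)); [lra|].
  intros l1 Hl1. apply NNPP; intro Hn.
  assert (A1 : annS l1) by (apply annS_exp with (H (0, 0)); auto; lra).
  assert (NP : forall z l, D z -> annS l -> Phi (pt l z) <> PInf).
  { intros; now apply (Phi_not_PInf D Phi HPhi). }
  assert (DZ0 : D (Z (0, 0))) by (apply DZ; rewrite C00; lra).
  destruct (Phi (pt l1 (Z (0, 0)))) as [|phi1|] eqn:E1;
    [apply Hn; simpl; auto| |now apply (NP (Z (0, 0)) l1)].
  simpl in Hn; apply Rnot_le_lt in Hn.
  destruct (usc_attains_max nearC (fun l => 0 <= Cmod l <= 1) (fun l => ER_addR (EFin 0) (- h l)))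
    as [lm [_ HM]].
  { apply compact_Cmod. }
  { apply usc_in_addR; [apply nearC_mono| |].
    - intros x k _ Hk; exists 1; split; [lra|]; intros y _ _; simpl in *; lra.
    - apply contC_in; intros; now apply contC_opp. }
  { discriminate. }
  { exists (0, 0); rewrite C00; lra. }
  set (Mh := Rabs (- h lm)). assert (HMh : 0 <= Mh) by apply Rabs_pos.
  assert (HM' : forall l, Cmod l <= 1 -> - h l <= Mh).
  { intros l Hl; specialize (HM l (conj (Cmod_ge0 l) Hl)); simpl in HM.
    pose proof (Rle_abs (- h lm)); unfold Mh; lra. }
  pose proof (Rabs_pos s); pose proof (Rabs_pos d).
  assert (Hrho2 : 0 < rho ^ 2) by now apply pow_lt.
  (* At distance [rho / 4] from the graph the penalty outweighs all the other terms, so a maximum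
     with positive value lies no farther from the graph than that. *)
  set (N := 16 * (Rabs s + Rabs d + Mh + eps) / rho ^ 2).
  assert (HN : 0 < N) by (apply Rdiv_lt_0_compat; lra).
  assert (EN : N * (rho / 4) ^ 2 = Rabs s + Rabs d + Mh + eps) by (unfold N; field; lra).
  (* As [H] takes values in [[rho, 1 - rho]] on the disc, points within [rho / 4] of the graph are
     interior to this shell in the variable [log |zeta|]. *)
  set (K := fun p : C * C => (0 <= Cmod (fst p) <= 1) /\
               (exp (rho / 2) <= Cmod (snd p) <= exp (1 - rho / 2))).
  assert (KS : forall p, K p -> D (Z (fst p)) /\ 0 < Cmod (snd p) /\
             rho / 2 <= logmod (snd p) <= 1 - rho / 2 /\ annS (snd p)).
  { intros p [[_ K1] K2]; apply logmod_between in K2 as [P K2].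
    repeat split; auto; try lra; apply annS_logmod; lra. }
  set (g := fun p : C * C => (- (s * logmod (snd p)) + (- d + (- h (fst p) + eps * Cmod (fst p) ^ 2)))
              + - N * ((logmod (snd p) + - H (fst p)) * (logmod (snd p) + - H (fst p)))).
  assert (K1 : K ((0, 0), l1)).
  { split; cbn [fst snd]; [rewrite C00; lra|].
    apply logmod_between; rewrite (logmod_exp l1 _ Hl1), Hl1; split; [apply exp_pos|lra]. }
  assert (mono := near_prod_mono nearC nearC nearC_mono nearC_mono).
  destruct (usc_attains_max (near_prod nearC nearC) K
              (fun p => ER_addR (Phi (pt (snd p) (Z (fst p)))) (g p))) as [[l0 m0] [K0 Hmax]].
  { apply (compact_prod nearC nearC (fun l => 0 <= Cmod l <= 1)
             (fun l => exp (rho / 2) <= Cmod l <= exp (1 - rho / 2)));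
    try apply compact_Cmod; apply nearC_mono. }
  { apply usc_in_addR; auto.
    - intros p k Kp Hk. destruct (KS p Kp) as [Dp [_ [_ Ap]]].
      destruct (Phi_usc D Phi HPhi (Z (fst p)) (snd p) k Dp Ap Hk) as [r [Hr Hu]].
      destruct (ballN_line A B) as [M [HM1 HB]].
      assert (0 < r / M) by now apply Rdiv_lt_0_compat.
      exists (Rmin r (r / M)); split; [now apply Rmin_glb_lt|].
      pose proof (Rmin_l r (r / M)); pose proof (Rmin_r r (r / M)).
      intros q Kq [N1 N2]; destruct (KS q Kq) as [Dq [_ [_ Aq]]]; unfold nearC in *.
      apply Hu; auto; [apply HB; auto|]; lra.
    - assert (cl : cont_in (near_prod nearC nearC) K (fun p => logmod (snd p))).
      { apply (cont_in_snd nearC nearC (fun l => 0 < Cmod l)); [intros; now apply KS|].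
        apply contC_in; intros; now apply logmod_contC. }
      assert (cf : forall f, (forall p, contC f p) ->
                cont_in (near_prod nearC nearC) K (fun p => f (fst p))).
      { intros f Hf; apply (cont_in_fst nearC nearC (fun _ => True)); auto; apply contC_in; auto. }
      assert (cH : cont_in (near_prod nearC nearC) K (fun p => logmod (snd p) + - H (fst p))).
      { apply cont_in_plus; auto; apply (cf (fun l => - H l)); intros.
        now apply contC_opp, harmonic_poly_contC. }
      unfold g; apply cont_in_plus; auto; [apply cont_in_plus; auto|].
      + apply (cont_in_snd nearC nearC (fun l => 0 < Cmod l) K (fun l => - (s * logmod l)));
          [intros; now apply KS|].
        apply contC_in; intros; apply contC_opp, (contC_mult (fun _ => s));
          [apply contC_const|now apply logmod_contC].
      + apply (cf (fun l => - d + (- h l + eps * Cmod l ^ 2))); intros; contC_auto; auto.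
      + apply cont_in_mult; auto; [apply (cf (fun _ => - N)); intros; apply contC_const|].
        now apply cont_in_mult. }
  { intros p Kp Hi; apply (NP (Z (fst p)) (snd p)); [apply KS; auto|apply KS; auto|].
    destruct (Phi (pt (snd p) (Z (fst p)))); auto; discriminate. }
  { eauto. }
  assert (Hstar := Hmax _ K1); cbn [fst snd] in Hstar; rewrite E1 in Hstar.
  destruct (KS _ K0) as [D0 [P0 [L0 A0]]]; cbn [fst snd] in D0, P0, L0, A0.
  destruct (Phi (pt m0 (Z l0))) as [|phi0|] eqn:E0; cbn [ER_addR ER_le] in Hstar; try contradiction;
    [|now apply (NP (Z l0) m0)].
  assert (Hphi0 : phi0 <= 0).
  { assert (Hneg := circle_le_neg D Phi HPhi (Z l0) (logmod m0) D0 ltac:(lra) m0).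
    rewrite E0 in Hneg; apply Hneg; now rewrite exp_logmod. }
  destruct K0 as [[_ K0] _]; cbn [fst snd] in K0.
  (* The starting point lies on the graph over the centre, where the penalty and [eps |l|^2] both
     vanish. *)
  assert (H0' : 3 * eps < phi0 + g (l0, m0)).
  { apply Rlt_le_trans with (2 := Hstar); unfold g; cbn [fst snd].
    rewrite C00, (logmod_exp l1 _ Hl1). nra. }
  unfold g in H0'; cbn [fst snd] in H0'.
  set (L := logmod m0) in *.
  assert (Hel : eps * Cmod l0 ^ 2 <= eps).
  { rewrite <- (Rmult_1_r eps) at 2; apply Rmult_le_compat_l; [lra|].
    pose proof (Cmod_ge0 l0); rewrite <- (pow1 2); apply pow_incr; lra. }
  assert (HsL : - (s * L) <= Rabs s).
  { rewrite Ropp_mult_distr_l. apply Rle_trans with (Rabs s * L).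
    - apply Rmult_le_compat_r; [lra|]. rewrite <- Rabs_Ropp; apply Rle_abs.
    - rewrite <- (Rmult_1_r (Rabs s)) at 2; apply Rmult_le_compat_l; lra. }
  assert (Hdd : - d <= Rabs d) by (rewrite <- Rabs_Ropp; apply Rle_abs).
  assert (Hpen : Rabs (L - H l0) <= rho / 4).
  { apply Rnot_lt_le; intro Hlt.
    assert (Hsq : (rho / 4) ^ 2 <= (L + - H l0) * (L + - H l0)).
    { replace ((L + - H l0) * (L + - H l0)) with (Rabs (L - H l0) ^ 2)
        by (rewrite pow2_abs; ring). apply pow_incr; lra. }
    apply (Rmult_le_compat_l N) in Hsq; [|lra].
    specialize (HM' l0 K0); lra. }
  assert (Hsq0 : 0 <= N * ((L + - H l0) * (L + - H l0))).
  { apply Rmult_le_pos; [lra|]. replace (_ * _) with ((L + - H l0) ^ 2) by ring. apply pow2_ge_0. }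
  (* Over the boundary circle the selection leaves at most [eps], and [eps |l|^2] adds another
     [eps]; the total [2 eps] is below the value [3 eps] that the maximum exceeds. *)
  assert (Hl0 : Cmod l0 < 1).
  { destruct K0 as [K0|K0]; auto; exfalso.
    assert (G := Hsel l0 L K0 Hpen m0); rewrite E0 in G; simpl in G.
    specialize (G ltac:(unfold L; now rewrite exp_logmod)). lra. }
  assert (Hran' := Hran l0 ltac:(lra)); apply Rabs_le_between in Hpen.
  destruct (harmonic_poly_harm2 H l0 HH) as [a [b Ha]].
  destruct (logmod_harm2 m0 a b P0) as [u [v [_ Hb]]].
  destruct (harmonic_harm2 (fun _ => True) h l0 1 Rlt_0_1 (fun _ _ => I) hh) as [a' [b' [Hh _]]].
  assert (Hm := harm2_plus _ _ _ _ _ _ Hb (harm2_scal (- 1) _ _ _ Ha)).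
  (* The choice of [(u, v)] makes the gradients cancel, as [harm2_sqr] requires. *)
  replace (a + -1 * a) with 0 in Hm by ring; replace (b + -1 * b) with 0 in Hm by ring.
  assert (HG := harm2_plus _ _ _ _ _ _ (harm2_scal s _ _ _ Hb)
    (harm2_plus _ _ _ _ _ _ Hh
       (harm2_plus _ _ _ _ _ _
          (harm2_quad 0 (- 2 * eps * fst l0) (- 2 * eps * snd l0) 0 0)
          (harm2_scal N _ _ _ (harm2_sqr _ Hm))))).
  cbv beta in HG.
  destruct (logmod_contC m0 P0 (rho / 4)) as [del [Hdel Hc]]; [lra|].
  (* The [1] avoids a division by zero: [(u, v)] vanishes where [H] is stationary. *)
  set (w := Cmod (u, v) + 1). assert (Hw : 1 <= w) by (pose proof (Cmod_ge0 (u, v)); unfold w; lra).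
  set (del' := Rmin del (Cmod m0) / w).
  assert (Hdel' : 0 < del') by (apply Rdiv_lt_0_compat; [now apply Rmin_glb_lt|lra]).
  assert (Ew : del' * w = Rmin del (Cmod m0)) by (unfold del'; field; lra).
  pose proof (Rmin_l del (Cmod m0)); pose proof (Rmin_r del (Cmod m0)).
  assert (Hr0 : 0 < Rmin del' (1 - Cmod l0)) by (apply Rmin_glb_lt; lra).
  pose proof (Rmin_l del' (1 - Cmod l0)); pose proof (Rmin_r del' (1 - Cmod l0)).
  apply (psh_touch_harm2 (DxS D) Phi (pt m0 (Z l0)) (pt (u, v) B) phi0 _ _ _ eps
           (Rmin del' (1 - Cmod l0)) (proj1 HPhi) E0 HG Heps Hr0).
  intros x y Hxy.
  apply (Cmod_lt (x, y)) in Hxy; [|lra].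
  rewrite line_pt. unfold Z; rewrite <- line_line; fold (Z (fst l0 + x, snd l0 + y)).
  set (m := (fst m0 + (x * u - y * v), snd m0 + (x * v + y * u))).
  set (l := (fst l0 + x, snd l0 + y)).
  assert (Nm : Cdist m m0 < Rmin del (Cmod m0)).
  { replace (Cdist m m0) with (Cmod (x, y) * Cmod (u, v)).
    - rewrite <- Ew. pose proof (Cmod_ge0 (x, y)); pose proof (Cmod_ge0 (u, v)).
      apply Rle_lt_trans with (Cmod (x, y) * w); [apply Rmult_le_compat_l; unfold w; lra|].
      apply Rmult_lt_compat_r; lra.
    - rewrite <- Cmod_mul; unfold Cdist, m, Cmul; f_equal; cbn [fst snd]; f_equal; ring. }
  assert (Kl : Cmod l <= 1).
  { assert (T := Cmod_triangle l0 (x, y)).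
    replace (Cadd l0 (x, y)) with l in T by reflexivity. lra. }
  assert (Pm : 0 < Cmod m).
  { pose proof (Cdist_triangle m0 m (0, 0)) as T; rewrite !Cdist_0, (Cdist_sym m0 m) in T; lra. }
  assert (Kp : K (l, m)).
  { split; cbn [fst snd]; [split; [apply Cmod_ge0|auto]|].
    apply logmod_between; split; auto. specialize (Hc m ltac:(lra)); fold L in Hc.
    apply Rabs_def2 in Hc; lra. }
  split; [split; [now apply DZ|]|].
  { now destruct (KS _ Kp) as [_ [_ [_ Am]]]. }
  specialize (Hmax _ Kp); unfold g in Hmax; cbn [fst snd] in Hmax.
  replace (fst m0 + (0 * u - 0 * v), snd m0 + (0 * v + 0 * u)) with m0
    by (destruct m0; simpl; f_equal; ring).
  replace (fst l0 + 0, snd l0 + 0) with l0 by (destruct l0; simpl; f_equal; ring).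
  fold L; fold L in Hmax; rewrite E0 in Hmax.
  destruct (Phi (pt m (Z l))) as [|phi|]; cbn [ER_addR ER_le] in Hmax |- *; auto.
  rewrite !Cmod_sqr in Hmax.
  assert (El : fst l = fst l0 + x /\ snd l = snd l0 + y) by (split; reflexivity).
  destruct El as [El1 El2]; rewrite El1, El2 in Hmax. unfold quad. lra.
Qed.

End Kiselev.

Lemma fibre_inf_psh {n} (D : Cn n -> Prop) (Phi : Cn (S n) -> ER) (s d : R) :
  PSHneg (DxS D) Phi -> psh_on D (fibre_inf Phi s d).
Proof.
  intros HPhi; apply no_touch_psh.
  - intros z Dz; now apply (fibre_inf_not_PInf D Phi HPhi).
  - now apply fibre_inf_usc.
  - intros A B c al be ga de kap r0 HA Hk Hr0 Ht.
    set (r := r0 / 2). assert (Hr : 0 < r < r0) by (unfold r; lra).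
    set (B' := Cn_scal (r, 0) B).
    assert (El : forall x y, Cn_add A (Cn_scal (x, y) B') = line A B (r * x) (r * y)).
    { intros x y; extensionality i; unfold B', line, Cn_add, Cn_scal, Cadd, Cmul; simpl; f_equal; ring. }
    assert (Hin : forall l, Cmod l <= 1 -> (r * fst l) ^ 2 + (r * snd l) ^ 2 < r0 ^ 2).
    { intros l Hl; apply Cmod_le in Hl; [|lra].
      replace ((r * fst l) ^ 2 + (r * snd l) ^ 2) with (r ^ 2 * (fst l ^ 2 + snd l ^ 2)) by ring.
      apply Rle_lt_trans with (r ^ 2 * 1 ^ 2); [apply Rmult_le_compat_l; [apply pow2_ge_0|auto]|].
      nra. }
    assert (Hkr : 0 < kap * r ^ 2) by (apply Rmult_lt_0_compat, pow_lt; lra).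
    set (h := fun l : C => (c - kap * r ^ 2) +
                quad (r * al) (r * be) (r ^ 2 * ga) (r ^ 2 * de) (fst l - 0) (snd l - 0)).
    (* On the unit circle [h] equals the rescaled touching polynomial, and [h (0, 0) = c - kap r^2].
       With [eps = kap r^2 / 6] the loss [3 eps] gives back only half of this gain. *)
    assert (H := fibre_inf_center D Phi HPhi s d A B' h (kap * r ^ 2 / 6)).
    assert (HC : ER_le (fibre_inf Phi s d A) (EFin (h (0, 0) + 3 * (kap * r ^ 2 / 6)))).
    { rewrite <- (line_0 A B') at 1; apply H.
      - intros p; apply (quad_contC (0, 0)).
      - lra.
      - intros [x y] Hl; rewrite El; now apply Ht, (Hin (x, y)).
      - intros [x y] Hl; rewrite El.
        eapply ER_le_trans; [apply Ht, (Hin (x, y)); lra|]; cbn [ER_le]; unfold h; cbn [fst snd].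
        apply Cmod_eq in Hl; [|lra]; cbn [fst snd] in Hl.
        assert (E : kap * ((r * x) ^ 2 + (r * y) ^ 2) = kap * r ^ 2).
        { replace (kap * ((r * x) ^ 2 + (r * y) ^ 2)) with (kap * r ^ 2 * (x ^ 2 + y ^ 2)) by ring.
          rewrite Hl; ring. }
        unfold quad; cbn [fst snd]; lra.
      - apply (quad_harmonic _ (0, 0)). }
    rewrite HA in HC; unfold h, quad in HC; simpl in HC; lra.
Qed.

(** * Supporting lines, boundary values and comparison with the envelope *)

(** By the three circles theorem every left chord slope is at most every right one, measured from
    the value [phi] at [l] and from arbitrary upper bounds [m] on the other circles; [p] is the
    supremum of the left slopes. *)
Lemma circle_support {n} (D : Cn n -> Prop) (Phi : Cn (S n) -> ER) z l phi :
  PSHneg (DxS D) Phi -> D z -> annS l -> Phi (pt l z) = EFin phi ->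
  exists p, forall t m, 0 < t < 1 -> circle_le Phi z t m -> phi + p * (t - logmod l) <= m.
Proof.
  intros HPhi Dz Al El.
  apply annS_logmod in Al as [Pl Ll]; set (t0 := logmod l) in *.
  assert (Cl : Cmod l = exp t0) by (unfold t0; now rewrite exp_logmod).
  assert (slopes : forall t1 m1 t2 m2, 0 < t1 < t0 -> t0 < t2 < 1 ->
            circle_le Phi z t1 m1 -> circle_le Phi z t2 m2 ->
            (phi - m1) / (t0 - t1) <= (m2 - phi) / (t2 - t0)).
  { intros t1 m1 t2 m2 H1 H2 C1 C2.
    set (b := (m2 - m1) / (t2 - t1)).
    assert (Eb : b * (t2 - t1) = m2 - m1) by (unfold b; field; lra).
    assert (C := three_circles D Phi HPhi z t1 t0 t2 (m1 - b * t1) b Dz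
                   ltac:(lra) ltac:(lra) ltac:(lra)).
    replace (m1 - b * t1 + b * t1) with m1 in C by ring.
    replace (m1 - b * t1 + b * t2) with m2 in C by lra.
    specialize (C C1 C2 l Cl); rewrite El in C; simpl in C.
    apply Rle_trans with b.
    - apply Rmult_le_reg_r with (t0 - t1); [lra|].
      unfold Rdiv; rewrite Rmult_assoc, Rinv_l by lra; lra.
    - apply Rmult_le_reg_r with (t2 - t0); [lra|].
      unfold Rdiv; rewrite Rmult_assoc, Rinv_l by lra; lra. }
  set (E := fun q => exists t m, 0 < t < t0 /\ circle_le Phi z t m /\ q = (phi - m) / (t0 - t)).
  destruct (completeness E) as [p [Hp1 Hp2]].
  (* [m = 0] is an upper bound on every circle: the midpoint circle on the right bounds the left
     slopes, the one on the left shows that there are some. *)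
  - exists ((0 - phi) / ((1 + t0) / 2 - t0)); intros q [t [m [Ht [C ->]]]].
    apply slopes; auto; [lra|]; apply (circle_le_neg D Phi HPhi); auto; lra.
  - exists ((phi - 0) / (t0 - t0 / 2)), (t0 / 2), 0; repeat split; try lra.
    apply (circle_le_neg D Phi HPhi); auto; lra.
  - exists p; intros t m Ht C.
    destruct (Rtotal_order t t0) as [Hlt|[->|Hgt]].
    + assert (Hq : (phi - m) / (t0 - t) <= p) by (apply Hp1; exists t, m; repeat split; auto; lra).
      apply (Rmult_le_compat_r (t0 - t)) in Hq; [|lra].
      unfold Rdiv in Hq; rewrite Rmult_assoc, Rinv_l in Hq by lra; lra.
    + specialize (C l Cl); rewrite El in C; simpl in C; lra.
    + assert (Hq : p <= (m - phi) / (t - t0)).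
      { apply Hp2; intros q [t1 [m1 [Ht1 [C1 ->]]]]; apply slopes; auto; lra. }
      apply (Rmult_le_compat_r (t - t0)) in Hq; [|lra].
      unfold Rdiv in Hq; rewrite Rmult_assoc, Rinv_l in Hq by lra; lra.
Qed.

(** As [0] bounds [Phi] on every circle, the infimum is at most that of [max(p, 0) - p t], which
    tends to [0] as [t] tends to [0] or to [1], according to the sign of [p]. *)
Lemma fibre_inf_PSHneg {n} (D : Cn n -> Prop) (Phi : Cn (S n) -> ER) (p : R) :
  PSHneg (DxS D) Phi -> PSHneg D (fibre_inf Phi p (- Rmax p 0)).
Proof.
  intros HPhi; split; [now apply fibre_inf_psh|]; intros z Dz.
  apply NNPP; intro Hn. destruct (ER_between _ _ Hn) as [k [Hk1 Hk2]].
  simpl in Hk1; apply Rnot_le_lt in Hk1; apply Hk2.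
  set (t := Rmin (1 / 2) (k / (Rabs p + 1))).
  pose proof (Rabs_pos p).
  assert (Ht : 0 < t) by (apply Rmin_glb_lt; [lra|apply Rdiv_lt_0_compat; lra]).
  assert (Ht2 : t <= 1 / 2) by apply Rmin_l.
  assert (Hpt : Rabs p * t <= k).
  { apply Rle_trans with ((Rabs p + 1) * (k / (Rabs p + 1))).
    - apply Rmult_le_compat; try lra; apply Rmin_r.
    - right; field; lra. }
  destruct (Rle_or_lt p 0) as [Hp|Hp].
  - apply fibre_inf_le with t; [lra|]; rewrite Rmax_right by lra.
    apply circle_le_mono with 0; [rewrite Rabs_left1 in Hpt by lra; lra|].
    apply (circle_le_neg D Phi HPhi); auto; lra.
  - apply fibre_inf_le with (1 - t); [lra|]; rewrite Rmax_left by lra.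
    apply circle_le_mono with 0; [rewrite Rabs_right in Hpt by lra; lra|].
    apply (circle_le_neg D Phi HPhi); auto; lra.
Qed.

(** Compactness of the boundary circle makes the threshold [k] valid over [z] in a neighbourhood of
    uniform width, which contains a circle of the open annulus. One circle suffices because
    [fibre_inf] is an infimum. *)
Lemma boundary_circle_le {n} (D : Cn n -> Prop) (Phi : Cn (S n) -> ER) z a tau :
  D z -> 0 <= tau <= 1 ->
  (forall l, Cmod l = exp tau ->
     ER_le (limsup_near (fun r p => ballN (pt l z) r p) (DxS D) Phi) a) ->
  forall k, ~ ER_le (EFin k) a -> exists t, 0 < t < 1 /\ circle_le Phi z t k.
Proof.
  intros Dz Htau Hb k Hk.
  destruct (compact_Cmod (exp tau) (exp tau) (fun W => exists del, 0 < del /\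
     forall l l', W l -> annS l' -> Cdist l' l < del -> ER_le (Phi (pt l' z)) (EFin k)))
    as [del [Hdel H]].
  - exists 1; split; [lra|tauto].
  - intros V W VW [d [Hd H]]; exists d; split; auto; intros; eapply H; eauto.
  - intros V W [d [Hd HV]] [d' [Hd' HW]]; exists (Rmin d d'); split; [now apply Rmin_glb_lt|].
    pose proof (Rmin_l d d'); pose proof (Rmin_r d d').
    intros l l' [Vl|Wl] Al Nl; [apply (HV l)|apply (HW l)]; auto; lra.
  - intros l Hl.
    destruct (proj1 (limsup_le_iff _ _ _ _) (Hb l ltac:(lra)) k Hk) as [r [Hr H]].
    exists (r / 2); split; [lra|]; exists (r / 2); split; [lra|].
    intros l1 l' [_ N1] Al Nl; apply H; [split; auto|].
    apply ballN_pt; split.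
    + unfold nearC in N1; pose proof (Cdist_triangle l' l1 l); lra.
    + intros i; rewrite Cdist_refl; lra.
  - destruct (radial_neighbour del Hdel) as [rho [Hrho Hr]].
    assert (Ht : exists t, 0 < t < 1 /\ Rabs (t - tau) < rho).
    { destruct (Rle_or_lt tau (1 / 2)).
      - exists (tau + Rmin (1 / 4) (rho / 2)).
        pose proof (Rmin_l (1 / 4) (rho / 2)); pose proof (Rmin_r (1 / 4) (rho / 2)).
        assert (0 < Rmin (1 / 4) (rho / 2)) by (apply Rmin_glb_lt; lra).
        split; [lra|]; apply Rabs_def1; lra.
      - exists (tau - Rmin (1 / 4) (rho / 2)).
        pose proof (Rmin_l (1 / 4) (rho / 2)); pose proof (Rmin_r (1 / 4) (rho / 2)).
        assert (0 < Rmin (1 / 4) (rho / 2)) by (apply Rmin_glb_lt; lra).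
        split; [lra|]; apply Rabs_def1; lra. }
    destruct Ht as [t [Ht Nt]]; exists t; split; auto; intros l' Hl'.
    destruct (Hr tau t l') as [l [El Nl]]; auto; [lra|].
    apply (H l); auto; [lra|now apply annS_exp with t].
Qed.

(** At a single [t] a bound [k] for [Phi] becomes [k - p t + max(p, 0)]; the estimate [- p t <= |p|]
    makes the constant independent of [z], as the definition of [g_u] requires. *)
Lemma fibre_inf_le_boundary {n} (Phi : Cn (S n) -> ER) z a p :
  (forall k, ~ ER_le (EFin k) a -> exists t, 0 < t < 1 /\ circle_le Phi z t k) ->
  ER_le (fibre_inf Phi p (- Rmax p 0) z) (ER_addR a (Rabs p + Rmax p 0)).
Proof.
  intros Ha; apply NNPP; intro Hn. destruct (ER_between _ _ Hn) as [k [Hk1 Hk2]].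
  apply Hk2. set (c := Rabs p + Rmax p 0) in *.
  destruct (Ha (k - c)) as [t [Ht C]].
  { intros Hc; apply Hk1; destruct a; simpl in *; auto; lra. }
  apply fibre_inf_le with t; auto; apply circle_le_mono with (2 := C).
  assert (Hpt : Rabs (p * t) <= Rabs p).
  { rewrite Rabs_mult, (Rabs_right t) by lra. rewrite <- (Rmult_1_r (Rabs p)) at 2.
    apply Rmult_le_compat_l; [apply Rabs_pos|lra]. }
  apply Rabs_le_between in Hpt; unfold c; lra.
Qed.

Lemma le_g_of {n} (D : Cn n -> Prop) (u w : Cn n -> ER) (c : R) z :
  PSHneg D w -> (forall y, D y -> ER_le (w y) (ER_addR (u y) c)) -> D z ->
  ER_le (w z) (g_of D u z).
Proof.
  intros Hw Hu Dz. apply ER_le_trans with (g_env D u z).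
  - apply ER_sup_spec; exists w; split; auto; split; eauto.
  - apply ER_le_limsup; auto; intros r Hr i; rewrite Cdist_refl; auto.
Qed.

Lemma Phi_le_Penv {n} (D : Cn n -> Prop) (u0 u1 : Cn n -> ER) (Phi : Cn (S n) -> ER) z l :
  PSHneg (DxS D) Phi -> boundary_cond D u0 u1 Phi -> D z -> annS l ->
  ER_le (Phi (pt l z)) (Penv D (g_of D u0) (g_of D u1) z).
Proof.
  intros HPhi [B0 B1] Dz Al.
  destruct (Phi (pt l z)) as [|phi|] eqn:E; [simpl; auto| |].
  2:{ exfalso; now apply (Phi_not_PInf D Phi HPhi z l). }
  destruct (circle_support D Phi z l phi HPhi Dz Al E) as [p Hp].
  set (w := fibre_inf Phi p (- Rmax p 0)).
  assert (Hw : PSHneg D w) by now apply fibre_inf_PSHneg.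
  apply ER_le_trans with (w z).
  - apply ER_inf_spec; intros a [k [t [Ht [C ->]]]]; simpl.
    specialize (Hp t _ Ht C). apply annS_logmod in Al as [_ Al].
    assert (p * logmod l <= Rmax p 0).
    { destruct (Rle_or_lt p 0); [rewrite Rmax_right by lra|rewrite Rmax_left by lra]; nra. }
    lra.
  - apply ER_sup_spec; exists w; split; [apply Hw|split; auto].
    intros y Dy; split; (eapply le_g_of; [exact Hw| |exact Dy]); intros x Dx;
    apply fibre_inf_le_boundary.
    + apply (boundary_circle_le D Phi x (u0 x) 0 Dx); [lra|].
      intros q Hq; apply B0; auto; unfold S0; now rewrite Hq, exp_0.
    + apply (boundary_circle_le D Phi x (u1 x) 1 Dx); [lra|].
      intros q Hq; apply B1; auto.
Qed.

(** * The envelope *)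

Lemma usc_on_ext {m} (Om : Cn m -> Prop) (u v : Cn m -> ER) :
  (forall z, Om z -> u z = v z) -> usc_on Om u -> usc_on Om v.
Proof.
  intros E Hu; apply usc_on_iff; intros z k Oz Hk; rewrite <- E in Hk by auto.
  destruct (proj1 (usc_on_iff _ _) Hu z k Oz Hk) as [r [Hr H]].
  exists r; split; auto; intros x Ox Nx; rewrite <- E by auto; auto.
Qed.

Definition usc_reg {m} (Om : Cn m -> Prop) (u : Cn m -> ER) (z : Cn m) : ER :=
  limsup_near (fun r x => ballN z r x) Om u.

Lemma le_usc_reg {m} (Om : Cn m -> Prop) (u : Cn m -> ER) z : Om z -> ER_le (u z) (usc_reg Om u z).
Proof.
  intros Oz; apply ER_le_limsup; auto; intros r Hr i; rewrite Cdist_refl; auto.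
Qed.

Lemma usc_reg_usc {m} (Om : Cn m -> Prop) (u : Cn m -> ER) : usc_on Om (usc_reg Om u).
Proof.
  apply usc_on_iff; intros z k Oz Hk.
  assert (Hz : ER_le (usc_reg Om u z) (usc_reg Om u z)) by apply ER_le_refl.
  destruct (proj1 (limsup_le_iff _ _ _ _) Hz k Hk) as [r [Hr H]].
  exists (r / 2); split; [lra|]; intros x Ox Nx.
  apply limsup_le_iff; intros k' Hk'; exists (r / 2); split; [lra|]; intros y Oy Ny.
  apply ER_le_trans with (EFin k).
  - apply H; auto; intros i; specialize (Nx i); specialize (Ny i).
    pose proof (Cdist_triangle (y i) (x i) (z i)); lra.
  - simpl in *; lra.
Qed.

(* A touching polynomial would, on a small circle, strictly dominate the regularisation, hence
   every member of the family on all translates of the circle by small vectors; the maximum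
   principle on a translate centred where a member nearly attains the regularisation is then
   violated. *)
Lemma usc_reg_sup_psh {m} (Om : Cn m -> Prop) (F : (Cn m -> ER) -> Prop) :
  let P := fun z => ER_sup (fun a => exists w, F w /\ a = w z) in
  open_set Om -> (forall w, F w -> psh_on Om w) ->
  (forall z, Om z -> usc_reg Om P z <> PInf) -> psh_on Om (usc_reg Om P).
Proof.
  intros P HO HF fin. apply no_touch_psh; auto; [apply usc_reg_usc|].
  intros A B c al be ga de kap r0 HA Hk Hr0 Ht.
  assert (OA : Om A) by (rewrite <- (line_0 A B); apply Ht; simpl; nra).
  destruct (HO A OA) as [rA [HrA HA']].
  destruct (ballN_line A B) as [M [HM HB]].
  (* Half of the margin [rA] is kept for the disc in direction [B], the other half for translating
     it. *)
  set (r := Rmin r0 (rA / 2 / M) / 2).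
  assert (HrM : 0 < rA / 2 / M) by (apply Rdiv_lt_0_compat; lra).
  assert (Hmin : 0 < Rmin r0 (rA / 2 / M)) by now apply Rmin_glb_lt.
  pose proof (Rmin_l r0 (rA / 2 / M)); pose proof (Rmin_r r0 (rA / 2 / M)).
  assert (Hr : 0 < r < r0) by (unfold r; lra). assert (HrM' : r < rA / 2 / M) by (unfold r; lra).
  (* The shift by [kap r^2 / 2] splits the gap: on the circle the touching polynomial lies this far
     below [h], and [h (0, 0)] lies this far below [c]. *)
  set (h := fun l : C => (c - kap * r ^ 2 / 2) + quad al be ga de (fst l - 0) (snd l - 0)).
  assert (hc : forall p, contC h p) by (intros; apply (quad_contC (0, 0))).
  assert (Hkr : 0 < kap * r ^ 2) by (apply Rmult_lt_0_compat, pow_lt; lra).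
  set (Z := fun l => Cn_add A (Cn_scal l B)).
  assert (HZ : forall l, Cmod l = r -> Om (Z l) /\
            ER_le (usc_reg Om P (Z l)) (EFin (h l - kap * r ^ 2 / 2))).
  { intros [x y] Hl; apply Cmod_eq in Hl; [|lra]; cbn [fst snd] in Hl.
    destruct (Ht x y) as [H1 H2]; [rewrite Hl; nra|]; split; auto.
    apply ER_le_trans with (1 := H2); cbn [ER_le]; unfold h; cbn [fst snd].
    rewrite Hl; unfold quad; lra. }
  destruct (compact_Cmod r r (fun W => exists rho, 0 < rho /\
     forall l x, W l -> Om x -> ballN (Z l) rho x -> ER_le (usc_reg Om P x) (EFin (h l))))
    as [rho [Hrho H']].
  - exists 1; split; [lra|tauto].
  - intros V W VW [d [Hd HV]]; exists d; split; auto.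
  - intros V W [d [Hd HV]] [d' [Hd' HW]]; exists (Rmin d d'); split; [now apply Rmin_glb_lt|].
    pose proof (Rmin_l d d'); pose proof (Rmin_r d d').
    intros l x [Vl|Wl] Ox Nx; [apply (HV l)|apply (HW l)]; auto; intros i; specialize (Nx i); lra.
  - intros l Hl; destruct (HZ l ltac:(lra)) as [Ol Zl].
    destruct (proj1 (usc_on_iff _ _) (usc_reg_usc Om P) (Z l) (h l - kap * r ^ 2 / 4) Ol)
      as [r1 [Hr1 H1]].
    { intros Hn; assert (Hc := ER_le_trans _ _ _ Hn Zl); simpl in Hc; lra. }
    destruct (hc l (kap * r ^ 2 / 4)) as [r2 [Hr2 H2]]; [lra|].
    assert (Hr1M : 0 < r1 / 2 / M) by (apply Rdiv_lt_0_compat; lra).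
    exists (Rmin r2 (r1 / 2 / M)); split; [now apply Rmin_glb_lt|].
    exists (r1 / 2); split; [lra|]; intros l' x [_ Nl] Ox Nx; unfold nearC in Nl.
    pose proof (Rmin_l r2 (r1 / 2 / M)); pose proof (Rmin_r r2 (r1 / 2 / M)).
    apply ER_le_trans with (EFin (h l - kap * r ^ 2 / 4)).
    + apply H1; auto; intros i; specialize (Nx i).
      assert (Nz := HB l l' (r1 / 2) ltac:(lra) ltac:(lra) i).
      pose proof (Cdist_triangle (x i) (Z l' i) (Z l i)); unfold Z in *; lra.
    + specialize (H2 l' ltac:(lra)); apply Rabs_def2 in H2; simpl; lra.
  - set (r3 := Rmin rho (rA / 2)). assert (Hr3 : 0 < r3) by (apply Rmin_glb_lt; lra).
    assert (L1 : r3 <= rho) by apply Rmin_l. assert (L2 : r3 <= rA / 2) by apply Rmin_r.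
    (* Otherwise every member, hence the supremum, would be at most [c - kap r^2 / 2] near [A], and
       so would the regularisation at [A]. *)
    assert (Hw : exists x w, Om x /\ ballN A r3 x /\ F w /\
              ~ ER_le (w x) (EFin (c - kap * r ^ 2 / 2))).
    { apply NNPP; intro Hn.
      assert (Hc : ER_le (usc_reg Om P A) (EFin (c - kap * r ^ 2 / 2))).
      { apply limsup_le_iff; intros k Hk'; exists r3; split; auto; intros x Ox Nx.
        apply ER_sup_spec; intros a [w [Fw ->]]; apply NNPP; intro Hlt.
        apply Hn; exists x, w; repeat split; auto; intros Hle; apply Hlt.
        apply ER_le_trans with (1 := Hle); simpl in *; lra. }
      rewrite HA in Hc; simpl in Hc; lra. }
    destruct Hw as [x [w [Ox [Nx [Fw Hw]]]]]; apply Hw.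
    assert (Hin : forall l, Cmod l <= r -> Om (Cn_add x (Cn_scal l B)) /\
              forall rr, ballN A rr x -> ballN (Z l) rr (Cn_add x (Cn_scal l B))).
    { intros l Hl.
      assert (Hball : forall rr, ballN A rr x -> ballN (Z l) rr (Cn_add x (Cn_scal l B))).
      { intros rr Nrr i; specialize (Nrr i).
        replace (Cdist _ _) with (Cdist (x i) (A i)); auto.
        unfold Cdist, Z, Cn_add, Cn_scal, Cadd; f_equal; simpl; f_equal; ring. }
      split; auto. apply HA'; intros i. specialize (Hball r3 Nx i).
      assert (Nz := HB (0, 0) l (rA / 2) ltac:(lra) ltac:(rewrite Cdist_0; lra) i).
      change (Cn_add A (Cn_scal (0, 0) B)) with (line A B 0 0) in Nz; rewrite line_0 in Nz.
      pose proof (Cdist_triangle (Cn_add x (Cn_scal l B) i) (Z l i) (A i)); unfold Z in *; lra. }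
    destruct (HF w Fw) as [_ [_ Hs]]; destruct (Hs x B) as [_ [_ Hmax]].
    assert (Hc := Hmax (0, 0) r h ltac:(lra)); clear Hmax Hs.
    assert (E0 : Cn_add x (Cn_scal (0, 0) B) = x) by apply (line_0 x B).
    assert (Hc0 : ER_le (w (Cn_add x (Cn_scal (0, 0) B))) (EFin (h (0, 0)))).
    { apply Hc.
      - intros l Hl; rewrite Cdist_0 in Hl; now apply Hin.
      - now apply contC_on.
      - apply (quad_harmonic _ (0, 0)).
      - intros l Hl; rewrite Cdist_0 in Hl.
        destruct (Hin l ltac:(lra)) as [Ol Nl].
        apply ER_le_trans with (P (Cn_add x (Cn_scal l B))); [apply ER_sup_spec; eauto|].
        apply ER_le_trans with (usc_reg Om P (Cn_add x (Cn_scal l B))); [now apply le_usc_reg|].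
        apply H'; auto; [lra|]; intros i; assert (N := Nl r3 Nx i); lra.
      - rewrite Cdist_refl; lra. }
    rewrite E0 in Hc0; apply ER_le_trans with (1 := Hc0); unfold h, quad; simpl; lra.
Qed.

Lemma psh_ext {m} (Om : Cn m -> Prop) (u v : Cn m -> ER) :
  (forall z, Om z -> u z = v z) -> psh_on Om u -> psh_on Om v.
Proof.
  intros E [fin [Hu Hs]]; split; [|split].
  - intros z Oz; rewrite <- E; auto.
  - now apply usc_on_ext with u.
  - intros a b; destruct (Hs a b) as [_ [_ Hm]]; split; [|split].
    + intros l Ol; rewrite <- E; auto.
    + apply usc_line; now apply usc_on_ext with u.
    + intros c r h Hr HU hc hh hb l Hl; rewrite <- E by (apply HU; lra).
      apply (Hm c r h); auto; intros q Hq; rewrite E; [now apply hb|apply HU; lra].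
Qed.

Lemma Penv_psh {n} (D : Cn n -> Prop) (f0 f1 : Cn n -> ER) :
  open_set D -> psh_on D f0 -> psh_on D f1 -> psh_on D (Penv D f0 f1).
Proof.
  intros HO [fin0 [usc0 _]] [_ [usc1 _]].
  set (F := fun w => psh_on D w /\ forall y, D y -> ER_le (w y) (f0 y) /\ ER_le (w y) (f1 y)).
  set (P := fun z => ER_sup (fun a => exists w, F w /\ a = w z)).
  assert (EP : forall z, Penv D f0 f1 z = P z).
  { intros z; apply ER_le_antisym; apply ER_sup_spec.
    - intros a [w [H1 [H2 ->]]]; apply ER_sup_spec; exists w; split; auto; split; auto.
    - intros a [w [[H1 H2] ->]]; apply ER_sup_spec; exists w; auto. }
  (* Upper semicontinuity of the majorant lets the bound survive the regularisation, which thus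
     becomes a member of the family. *)
  assert (reg_le : forall f, usc_on D f -> (forall w y, F w -> D y -> ER_le (w y) (f y)) ->
            forall z, D z -> ER_le (usc_reg D P z) (f z)).
  { intros f Hf HF z Dz; apply limsup_le_iff; intros k Hk.
    destruct (proj1 (usc_on_iff _ _) Hf z k Dz Hk) as [r [Hr H]].
    exists r; split; auto; intros x Dx Nx; apply ER_le_trans with (2 := H x Dx Nx).
    apply ER_sup_spec; intros a [w [Fw ->]]; auto. }
  assert (R0 : forall z, D z -> ER_le (usc_reg D P z) (f0 z)).
  { apply reg_le; auto; intros w y [_ H] Dy; now apply H. }
  assert (R1 : forall z, D z -> ER_le (usc_reg D P z) (f1 z)).
  { apply reg_le; auto; intros w y [_ H] Dy; now apply H. }
  assert (Hreg : psh_on D (usc_reg D P)).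
  { apply usc_reg_sup_psh; auto; [now intros w [Hw _]|].
    intros z Dz E; specialize (R0 z Dz); fold P in E; rewrite E in R0; apply (fin0 z Dz).
    destruct (f0 z); auto; contradiction. }
  apply psh_ext with (2 := Hreg); intros z Dz; rewrite EP; apply ER_le_antisym.
  - apply ER_sup_spec; exists (usc_reg D P); split; auto; split; auto.
  - now apply le_usc_reg.
Qed.

(** The projection maps complex lines to complex lines or points, so slices of the pullback are
    slices of [u]. *)
Lemma psh_tl {n} (D : Cn n -> Prop) (u : Cn n -> ER) :
  psh_on D u -> psh_on (DxS D) (fun p => u (tl p)).
Proof.
  intros [fin [Hu Hs]].
  assert (Hu' : usc_on (DxS D) (fun p => u (tl p))).
  { apply usc_on_iff; intros p k [Dp _] Hk.
    destruct (proj1 (usc_on_iff _ _) Hu (tl p) k Dp Hk) as [r [Hr H]].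
    exists r; split; auto; intros q [Dq _] Nq; apply H; auto; intros i; apply Nq. }
  split; [intros p [Dp _]; now apply fin|split; [auto|]]; intros a b.
  destruct (Hs (tl a) (tl b)) as [fin' [_ Hm]]; split; [|split].
  - intros l [Dl _]; now apply fin'.
  - exact (usc_line _ _ a b Hu').
  - intros c r h Hr HU hc hh hb; apply (Hm c r h); auto.
    intros l Hl; now apply (HU l).
Qed.

Theorem theorem6p2 (n : nat) (D : Cn n -> Prop) (u0 u1 : Cn n -> ER) :
  bounded_hyperconvex D ->
  PSHneg D u0 -> PSHneg D u1 ->
  minf_closed_in D u0 -> loc_bdd_off_poles D u0 ->
  minf_closed_in D u1 -> loc_bdd_off_poles D u1 ->
  (forall Phi : Cn (S n) -> ER,
     PSHneg (DxS D) Phi -> boundary_cond D u0 u1 Phi ->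
     forall z zeta, D z -> annS zeta ->
       ER_le (Phi (pt zeta z)) (Penv D (g_of D u0) (g_of D u1) z)) /\
  ((forall z, D z -> u0 z = g_of D u0 z) ->
   (forall z, D z -> u1 z = g_of D u1 z) ->
   PSHneg (DxS D) (fun p => Penv D (g_of D u0) (g_of D u1) (tl p)) /\
   boundary_cond D u0 u1 (fun p => Penv D (g_of D u0) (g_of D u1) (tl p))).
Proof.
  intros [HO _] [psh0 neg0] [psh1 neg1] _ _ _ _; split.
  - intros; now apply Phi_le_Penv.
  - intros G0 G1.
    set (P := Penv D (g_of D u0) (g_of D u1)).
    assert (PP : psh_on D P).
    (* Here each [g_of] coincides on [D] with the given function and is therefore
       plurisubharmonic. *)
    { apply Penv_psh; auto; eapply psh_ext; eauto. }
    assert (P0 : forall z, D z -> ER_le (P z) (u0 z)).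
    { intros z Dz; apply ER_sup_spec; intros a [w [_ [H ->]]]; rewrite G0 by auto; now apply H. }
    assert (P1 : forall z, D z -> ER_le (P z) (u1 z)).
    { intros z Dz; apply ER_sup_spec; intros a [w [_ [H ->]]]; rewrite G1 by auto; now apply H. }
    (* Constancy in [zeta] reduces the boundary limit to upper semicontinuity of [P] at [z]. *)
    assert (Plim : forall z l, D z ->
              ER_le (limsup_near (fun r p => ballN (pt l z) r p) (DxS D) (fun p => P (tl p))) (P z)).
    { intros z l Dz; apply limsup_le_iff; intros k Hk.
      destruct PP as [_ [uP _]].
      destruct (proj1 (usc_on_iff _ _) uP z k Dz Hk) as [r [Hr H]].
      exists r; split; auto; intros q [Dq _] Nq; apply H; auto; intros i; apply (Nq (Fin.FS i)). }
    split; [split|split].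
    + now apply psh_tl.
    + intros p [Dp _]; apply ER_le_trans with (2 := neg0 _ Dp); auto.
    + intros z l Dz _; apply ER_le_trans with (2 := P0 z Dz); auto.
    + intros z l Dz _; apply ER_le_trans with (2 := P1 z Dz); auto.
Qed.
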